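(* Let $\mathcal A=\langle S,T,P\rangle$ be a SETAu (not necessarily flat) satisfying restriction (R): in every ETPu $P(t)$, $t\in T$, on at least one of its transitions some clock is compared with a positive lower bound (so there is a positive minimal duration $D$ needed to traverse any $P(t)$). Then, for any energy constraint $E$ and initial macro-configuration $(s_0,w_0)$, the energy-constrained infinite-run problem (existence of a strategy all of whose outcomes from $(s_0,w_0)$ satisfy $E$) is decidable.
   Context: An energy timed automaton (ETA) is a tuple $\langle S,S_0,X,\mathrm{Inv},r,T\rangle$ with finite states, initial states, finite clock set $X$, invariants that are conjunctions of closed clock constraints $x\bowtie c$ ($\bowtie\in\{\le,\ge,=\}$, $c$ rational), rates $r\colon S\to\mathbb Q$, and transitions $t=(s,g,u,z,s')$ with closed guard $g$, update $u\in\mathbb Q$ and reset set $z\subseteq X$. An ETA with uncertainty (ETAu) additionally has $\epsilon\colon S\to\mathbb Q_{>0}$ and $\Delta\colon T\to\mathbb Q_{>0}$. For transitions $t_i=(s_i,g_i,u_i,z_i,s_{i+1})$, $0\le i<n$, and delays $d=(d_i)$, a possible outcome is a sequence $(\ell_j,v_j,w_j)_{0\le j\le 2n}$ with $\ell_{2j}=\ell_{2j+1}=s_j$, $\ell_{2n}=s_n$, $v_{2j+1}=v_{2j}+d_j$, $v_{2j+2}=v_{2j+1}[z_j\to0]$, $v_{2j}\models\mathrm{Inv}(s_j)$, $v_{2j+1}\models\mathrm{Inv}(s_j)\wedge g_j$, $w_{2j+1}=w_{2j}+d_j\alpha_j$, $w_{2j+2}=w_{2j+1}+\beta_j$ for some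 $\alpha_j\in[r(s_j)-\epsilon(s_j),r(s_j)+\epsilon(s_j)]$ and $\beta_j\in[u_j-\Delta(t_j),u_j+\Delta(t_j)]$. An energy constraint is a closed interval $E$ with rational bounds; an outcome satisfies $E$ if all its $w_j\in E$. An ETPu from $s_0$ to $s_n$ is an ETAu whose states $s_0,\dots,s_n$ are linked by exactly one transition from $s_i$ to $s_{i+1}$ each. A SETAu $\langle S,T,P\rangle$ consists of a finite directed graph $(S,T)$ of macro-states and a map $P$ assigning to each edge $(m,m')$ an ETPu from $m$ to $m'$. A (memoryless) strategy maps each macro-configuration $(s,w)$ ($s\in S$, $w\in E$) to a pair $(t,d)$ where $t=(s,s')\in T$ and $d$ is a delay sequence for $P(t)$. An execution $(\rho^i)_i$ is an outcome of the strategy from $(s_0,w_0)$ if each $\rho^i$ is a possible outcome of the ETPu $P(t)$ chosen by the strategy at $(s^i_0,w^i_0)$ with the chosen delays, starting from clock valuation $\mathbf 0$ and ending at the target macro-state with valuation $\mathbf 0$, and each $\rho^{i+1}$ starts in the macro-state and energy level where $\rho^i$ ends. The energy-constrained infinite-run problem asks whether there exists a strategy such that all infinite outcomes from $(s_0,w_0)$ satisfy $E$. *)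

(* Defs.v *)
From Stdlib Require Import Reals QArith Qreals List Arith.
Import ListNotations.
Open Scope R_scope.

Inductive cmp := CLe | CGe | CEq.

Record atom := mkAtom { a_clk : nat; a_op : cmp; a_c : Q }.

Record loc := mkLoc { l_inv : list atom; l_rate : Q; l_eps : Q }.

Record trans := mkTrans { t_guard : list atom; t_upd : Q; t_delta : Q;
                          t_reset : list nat }.

(* An ETPu from s_0 to s_n with clock set X = {0,..,p_nclk-1}:
   p_steps = [(s_0,t_0); ...; (s_{n-1},t_{n-1})] where t_i goes from s_i to s_{i+1},
   and p_last = s_n.  Each position is a distinct state of the path. *)
Record etpu := mkETPu { p_nclk : nat; p_steps : list (loc * trans); p_last : loc }.

(* A SETAu: macro-states {0,..,nS-1}; edges (m, m', P(m,m')). *)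
Record setau := mkSETAu { nS : nat; edges : list (nat * nat * etpu) }.

Definition atom_wf (n : nat) (a : atom) : Prop := (a_clk a < n)%nat.

Definition loc_wf (n : nat) (l : loc) : Prop :=
  Forall (atom_wf n) (l_inv l) /\ (0 < l_eps l)%Q.

Definition trans_wf (n : nat) (t : trans) : Prop :=
  Forall (atom_wf n) (t_guard t) /\ Forall (fun x => (x < n)%nat) (t_reset t)
  /\ (0 < t_delta t)%Q.

Definition wf_etpu (p : etpu) : Prop :=
  Forall (fun lt => loc_wf (p_nclk p) (fst lt) /\ trans_wf (p_nclk p) (snd lt))
         (p_steps p)
  /\ loc_wf (p_nclk p) (p_last p).

(* edges have endpoints in S, each edge (m,m') appears once (T is a set and
   P is a function on T), and each P(t) is a well-formed ETPu *)
Definition wf_setau (A : setau) : Prop :=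
  (forall s s' p, In (s, s', p) (edges A) ->
     (s < nS A)%nat /\ (s' < nS A)%nat /\ wf_etpu p)
  /\ NoDup (map fst (edges A)).

Definition restrictionR (A : setau) : Prop :=
  forall s s' p, In (s, s', p) (edges A) ->
    exists lt, In lt (p_steps p) /\
      exists a, In a (t_guard (snd lt)) /\
        (a_op a = CGe \/ a_op a = CEq) /\ (0 < a_c a)%Q.

Definition valuation := nat -> R.

Definition atom_sat (v : valuation) (a : atom) : Prop :=
  match a_op a with
  | CLe => v (a_clk a) <= Q2R (a_c a)
  | CGe => v (a_clk a) >= Q2R (a_c a)
  | CEq => v (a_clk a) = Q2R (a_c a)
  end.

Definition sat (v : valuation) (g : list atom) : Prop := Forall (atom_sat v) g.

Definition vdelay (v : valuation) (d : R) : valuation := fun x => v x + d.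

Definition vreset (v : valuation) (z : list nat) : valuation :=
  fun x => if existsb (Nat.eqb x) z then 0 else v x.

(* Clock part of an outcome from valuation v with delays ds:
   v_{2j} |= Inv(s_j), v_{2j+1} = v_{2j}+d_j |= Inv(s_j) /\ g_j,
   v_{2j+2} = v_{2j+1}[z_j -> 0], delays nonnegative, and (as required for
   executions of a SETAu) the final valuation v_{2n} is 0 on all clocks of X. *)
Fixpoint clock_ok (nclk : nat) (v : valuation) (st : list (loc * trans))
         (ds : list R) : Prop :=
  match st, ds with
  | [], [] => forall x, (x < nclk)%nat -> v x = 0
  | (l, t) :: st', d :: ds' =>
      0 <= d /\ sat v (l_inv l) /\ sat (vdelay v d) (l_inv l)
      /\ sat (vdelay v d) (t_guard t)
      /\ clock_ok nclk (vreset (vdelay v d) (t_reset t)) st' ds'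
  | _, _ => False
  end.

Fixpoint energy_ok (w : R) (st : list (loc * trans)) (ds : list R)
         (ws : list R) : Prop :=
  match st, ds, ws with
  | [], [], [] => True
  | (l, t) :: st', d :: ds', w1 :: w2 :: ws' =>
      (exists alpha, Q2R (l_rate l) - Q2R (l_eps l) <= alpha
                     <= Q2R (l_rate l) + Q2R (l_eps l) /\ w1 = w + d * alpha)
      /\ (exists beta, Q2R (t_upd t) - Q2R (t_delta t) <= beta
                       <= Q2R (t_upd t) + Q2R (t_delta t) /\ w2 = w1 + beta)
      /\ energy_ok w2 st' ds' ws'
  | _, _, _ => False
  end.

Definition delay_seq (p : etpu) (ds : list R) : Prop :=
  clock_ok (p_nclk p) (fun _ => 0) (p_steps p) ds.

Definition etpu_outcome (p : etpu) (w : R) (ds : list R) (ws : list R) : Prop :=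
  delay_seq p ds /\ energy_ok w (p_steps p) ds ws.

Definition inE (lo hi : Q) (x : R) : Prop := Q2R lo <= x <= Q2R hi.

(* memoryless strategy: (s, w) |-> (target macro-state s', delays d);
   the chosen edge is t = (s, s') *)
Definition strategy := nat -> R -> (nat * list R).

Definition valid_strategy (A : setau) (lo hi : Q) (sg : strategy) : Prop :=
  forall s w, (s < nS A)%nat -> inE lo hi w ->
    exists p, In (s, fst (sg s w), p) (edges A) /\ delay_seq p (snd (sg s w)).

Definition execution_prefix (A : setau) (sg : strategy) (s0 : nat) (w0 : R)
  (k : nat) (ss : nat -> nat) (ws : nat -> R) (rho : nat -> list R) : Prop :=
  ss O = s0 /\ ws O = w0 /\
  forall i, (i < k)%nat ->
    exists p, In (ss i, fst (sg (ss i) (ws i)), p) (edges A)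
      /\ etpu_outcome p (ws i) (snd (sg (ss i) (ws i))) (rho i)
      /\ ss (S i) = fst (sg (ss i) (ws i))
      /\ ws (S i) = last (rho i) (ws i).

Definition infinite_run_problem (A : setau) (lo hi : Q) (s0 : nat) (w0 : Q)
  : Prop :=
  exists sg : strategy, valid_strategy A lo hi sg /\
    forall k ss ws rho, execution_prefix A sg s0 (Q2R w0) k ss ws rho ->
      (forall i, (i <= k)%nat -> inE lo hi (ws i)) /\
      (forall i, (i < k)%nat -> Forall (inE lo hi) (rho i)).

Inductive term := Var (n : nat) | App (s t : term) | Lam (s : term).

Fixpoint lift (k c : nat) (t : term) : term :=
  match t with
  | Var n => if Nat.ltb n c then Var n else Var (n + k)
  | App a b => App (lift k c a) (lift k c b)
  | Lam a => Lam (lift k (S c) a)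
  end.

Fixpoint subst (s : term) (k : nat) (u : term) : term :=
  match s with
  | Var n => if Nat.eqb n k then lift k 0 u
             else if Nat.ltb k n then Var (pred n) else Var n
  | App a b => App (subst a k u) (subst b k u)
  | Lam a => Lam (subst a (S k) u)
  end.

Fixpoint step (t : term) : option term :=
  match t with
  | Var _ => None
  | Lam s => option_map Lam (step s)
  | App s u =>
      match s with
      | Lam b => Some (subst b 0 u)
      | _ => match step s with
             | Some s' => Some (App s' u)
             | None => option_map (App s) (step u)
             end
      end
  end.

Fixpoint evaln (n : nat) (t : term) : option term :=
  match step t with
  | None => Some t
  | Some t' => match n with O => None | S n' => evaln n' t' end
  end.

Definition ltrue : term := Lam (Lam (Var 1)).
Definition lfalse : term := Lam (Lam (Var 0)).

(* binary trees as input data, Scott-encoded as lambda terms *)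
Inductive tree := Leaf | Node (l r : tree).

Fixpoint tenc (x : tree) : term :=
  match x with
  | Leaf => Lam (Lam (Var 1))
  | Node a b => Lam (Lam (App (App (Var 0) (tenc a)) (tenc b)))
  end.

Definition decides_on (p : term) (x : tree) (P : Prop) : Prop :=
  exists n, (evaln n (App p (tenc x)) = Some ltrue /\ P)
         \/ (evaln n (App p (tenc x)) = Some lfalse /\ ~ P).

Fixpoint encN (n : nat) : tree :=
  match n with O => Leaf | S m => Node Leaf (encN m) end.

Fixpoint encP (p : positive) : tree :=
  match p with
  | xH => Leaf
  | xO q => Node Leaf (encP q)
  | xI q => Node (Node Leaf Leaf) (encP q)
  end.

Definition encZ (z : Z) : tree :=
  match z with
  | Z0 => Leaf
  | Zpos p => Node Leaf (encP p)
  | Zneg p => Node (Node Leaf Leaf) (encP p)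
  end.

Definition encQ (q : Q) : tree := Node (encZ (Qnum q)) (encP (Qden q)).

Fixpoint encL {X : Type} (f : X -> tree) (l : list X) : tree :=
  match l with [] => Leaf | x :: l' => Node (f x) (encL f l') end.

Definition encCmp (c : cmp) : tree :=
  match c with
  | CLe => Leaf | CGe => Node Leaf Leaf | CEq => Node Leaf (Node Leaf Leaf)
  end.

Definition encAtom (a : atom) : tree :=
  Node (encN (a_clk a)) (Node (encCmp (a_op a)) (encQ (a_c a))).

Definition encLoc (l : loc) : tree :=
  Node (encL encAtom (l_inv l)) (Node (encQ (l_rate l)) (encQ (l_eps l))).

Definition encTrans (t : trans) : tree :=
  Node (encL encAtom (t_guard t))
       (Node (encQ (t_upd t)) (Node (encQ (t_delta t)) (encL encN (t_reset t)))).

Definition encETPu (p : etpu) : tree :=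
  Node (encN (p_nclk p))
       (Node (encL (fun lt => Node (encLoc (fst lt)) (encTrans (snd lt)))
                   (p_steps p))
             (encLoc (p_last p))).

Definition encSETAu (A : setau) : tree :=
  Node (encN (nS A))
       (encL (fun e => Node (Node (encN (fst (fst e))) (encN (snd (fst e))))
                            (encETPu (snd e))) (edges A)).

Definition enc_inst (A : setau) (lo hi : Q) (s0 : nat) (w0 : Q) : tree :=
  Node (encSETAu A) (Node (Node (encQ lo) (encQ hi)) (Node (encN s0) (encQ w0))).

(* Main.v *)
Require Import Defs.
From Stdlib Require Import Reals QArith Qreals List Arith ZArith Lia Lra Psatz.
From Stdlib Require Import FunctionalExtensionality PropExtensionality ClassicalEpsilon.
From Stdlib Require Import Relation_Operators.
Import ListNotations.

(* Every traversal of an edge widens the interval of possible energies by at least twice the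
   uncertainty of one of its updates, so the final energies of a traversal fill an interval of
   length bounded below by some [eta > 0]. A set of winning energies therefore matters only through
   its maximal subintervals of length at least [eta], and each of these contains a point of a fixed
   finite grid in [E]. Hence a winning strategy exists iff, for every macro-state, there is one
   interval per grid point such that from each energy in these intervals, and from [w0], some edge
   and delays keep [E] and end inside one of the intervals. This is a sentence of linear real
   arithmetic, decided by Fourier-Motzkin elimination on disjunctive normal forms.

   The decision procedure is an ordinary function [tree -> bool]; it is turned into a lambda term by
   showing that the functions with a call-by-name realizer contain the recursors and are closed
   under application and abstraction. *)

(** Two obstacles shape the reduction. The uncertainty of a rate enters as a product [d * alpha] of
    two unknowns, which is not linear. For fixed delays, however, the possible energies form an
    interval whose ends come from the extreme rates and updates; these ends are linear in the
    delays, so no quantifier over the uncertainty remains. Next, the winning energies form a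
    greatest fixed point over sets of reals, whose iteration need not stop. An invariant is guessed
    instead, and the sentence only asks that one traversal preserve it; since the number of
    intervals is computed from the input beforehand, the guess has finitely many real parameters. A
    positive rational is at least the reciprocal of its denominator, so [eta] is [1/M], with [M] the
    sum of the denominators of all update uncertainties plus one, and the grid consists of the
    points [lo + k/M]. Restriction (R) guarantees that every path has a transition, hence an update
    that widens the interval. The energy [w0] is treated apart because a single point may lie in no
    long interval. A strategy must also give legal moves where it can never arrive, which is a
    separate condition [all_valid]. *)

Local Open Scope R_scope.
Local Obligation Tactic := idtac.

(** * Realizability in the lambda calculus *)

(** [bound 0] is closedness. Realizers are kept closed so that [lift] and [subst] leave them alone
    and reductions need no index arithmetic. *)
Fixpoint bound (k : nat) (t : term) : Prop :=
  match t with
  | Var n => (n < k)%nat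
  | App a b => bound k a /\ bound k b
  | Lam a => bound (S k) a
  end.

Lemma bound_mono t : forall k k', (k <= k')%nat -> bound k t -> bound k' t.
Proof.
  induction t; simpl; intros k k' Hk H.
  - lia.
  - destruct H; split; eauto.
  - apply (IHt (S k)); [lia | assumption].
Qed.

Lemma lift_bound t : forall k n c, (k <= c)%nat -> bound k t -> lift n c t = t.
Proof.
  induction t; simpl; intros k m c Hk H.
  - destruct (Nat.ltb_spec n c); [reflexivity | lia].
  - destruct H; erewrite IHt1, IHt2; eauto.
  - erewrite IHt; [reflexivity | | eassumption]; lia.
Qed.

Lemma subst_bound t : forall k c u, (k <= c)%nat -> bound k t -> subst t c u = t.
Proof.
  induction t; simpl; intros k c u Hk H.
  - destruct (Nat.eqb_spec n c); [lia |].
    destruct (Nat.ltb_spec c n); [lia | reflexivity].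
  - destruct H; erewrite IHt1, IHt2; eauto.
  - erewrite IHt; [reflexivity | | eassumption]; lia.
Qed.

Lemma bound_lift t : forall k n c, bound k t -> bound (k + n) (lift n c t).
Proof.
  induction t; simpl; intros k m c H.
  - destruct (Nat.ltb_spec n c); simpl; lia.
  - destruct H; split; auto.
  - apply (IHt (S k)); assumption.
Qed.

Lemma bound_subst t : forall k c u, bound (S (k + c)) t -> bound k u ->
  bound (k + c) (subst t c u).
Proof.
  induction t; simpl; intros k c u H Hu.
  - destruct (Nat.eqb_spec n c).
    + apply bound_lift; assumption.
    + destruct (Nat.ltb_spec c n); simpl; lia.
  - destruct H; split; auto.
  - rewrite plus_n_Sm; apply IHt; [rewrite <- plus_n_Sm |]; assumption.
Qed.

Inductive whs : term -> term -> Prop :=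
| whs_beta b u : whs (App (Lam b) u) (subst b 0 u)
| whs_app s s' u : whs s s' -> whs (App s u) (App s' u).

Definition wh := clos_refl_trans_1n term whs.

(** Only applications take weak head steps. The head of a larger application that still reduces is
    therefore no [Lam], and [step] descends into it as [whs] does. *)
Lemma whs_step s s' : whs s s' -> step s = Some s'.
Proof.
  induction 1; simpl; [reflexivity |].
  destruct s; try (inversion H; fail); rewrite IHwhs; reflexivity.
Qed.

Lemma whs_bound s s' : whs s s' -> bound 0 s -> bound 0 s'.
Proof.
  induction 1; simpl; intros [H1 H2].
  - apply (bound_subst b 0 0 u); assumption.
  - split; auto.
Qed.

Lemma wh_refl t : wh t t.
Proof. apply rt1n_refl. Qed.

Lemma wh_trans a b c : wh a b -> wh b c -> wh a c.
Proof.
  induction 1; intros; [assumption |].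
  eapply rt1n_trans; [eassumption |]; apply IHclos_refl_trans_1n; assumption.
Qed.

Lemma wh_app s s' u : wh s s' -> wh (App s u) (App s' u).
Proof.
  induction 1; [apply wh_refl |].
  eapply rt1n_trans; [apply whs_app |]; eassumption.
Qed.

Lemma wh_beta b u t : wh (subst b 0 u) t -> wh (App (Lam b) u) t.
Proof. intros H; eapply rt1n_trans; [apply whs_beta | exact H]. Qed.

Lemma wh_evaln t v : wh t v -> step v = None -> exists n, evaln n t = Some v.
Proof.
  induction 1 as [| a b c Hab _ IH]; intros Hv.
  - exists O; simpl; rewrite Hv; reflexivity.
  - destruct (IH Hv) as [n Hn]; exists (S n); simpl.
    rewrite (whs_step _ _ Hab); exact Hn.
Qed.

(* Call-by-name realizability: a realizer need not be a normal form, only to head-reduce to a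
   Scott constructor whose arguments are again realizers. *)
Class Rep (A : Type) := {
  rep : A -> term -> Prop;
  rep_closed : forall x t, rep x t -> bound 0 t;
  rep_exp1 : forall x t t', bound 0 t -> whs t t' -> rep x t' -> rep x t }.

Lemma rep_exp {A} `{Rep A} (x : A) t t' : bound 0 t -> wh t t' -> rep x t' -> rep x t.
Proof.
  intros Hb Hw Hr; induction Hw; [assumption |].
  eapply rep_exp1; [assumption | eassumption |].
  apply IHHw; [eapply whs_bound; eassumption | assumption].
Qed.

#[global] Program Instance Rep_fun A B `{Rep A} `{Rep B} : Rep (A -> B) :=
  {| rep f t := bound 0 t /\ forall a u, rep a u -> rep (f a) (App t u) |}.
Next Obligation. intros A B RA RB f t Hr; apply Hr. Qed.
Next Obligation.
  intros A B RA RB f t t' Hb Hs [_ Hf]; split; [assumption |].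
  intros a u Hu; apply rep_exp1 with (App t' u).
  - split; [assumption | exact (rep_closed _ _ Hu)].
  - apply whs_app; assumption.
  - apply Hf; assumption.
Qed.

Program Definition Rep_data {A} (V : A -> term -> Prop) : Rep A :=
  {| rep x t := bound 0 t /\ exists v, wh t v /\ V x v |}.
Next Obligation. intros A V x t Hr; apply Hr. Qed.
Next Obligation.
  intros A V x t t' Hb Hs [_ [v [Hw Hv]]]; split; [assumption |].
  exists v; split; [eapply rt1n_trans; eassumption | assumption].
Qed.

Definition sbool (b : bool) : term := if b then ltrue else lfalse.

#[global] Instance Rep_bool : Rep bool := Rep_data (fun b v => v = sbool b).

#[global] Instance Rep_prod A B `{Rep A} `{Rep B} : Rep (A * B) :=
  Rep_data (fun p v => exists a b, v = Lam (App (App (Var 0) a) b)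
                                   /\ rep (fst p) a /\ rep (snd p) b).

(** The clause for [S] refers to the relation at the predecessor, hence a recursion on the number in
    place of [Rep_data]. *)
Fixpoint rep_nat (n : nat) (t : term) : Prop :=
  bound 0 t /\
  match n with
  | O => wh t (Lam (Lam (Var 1)))
  | S m => exists u, wh t (Lam (Lam (App (Var 0) u))) /\ rep_nat m u
  end.

#[global] Program Instance Rep_nat : Rep nat := {| rep := rep_nat |}.
Next Obligation. intros [|n] t Hr; apply Hr. Qed.
Next Obligation.
  intros [|n] t t' Hb Hs [_ Hr]; split; try assumption.
  - eapply rt1n_trans; eassumption.
  - destruct Hr as [u [Hw Hr]]; exists u; split; [eapply rt1n_trans |]; eassumption.
Qed.

Fixpoint rep_tree (x : tree) (t : term) : Prop :=
  bound 0 t /\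
  match x with
  | Leaf => wh t (Lam (Lam (Var 1)))
  | Node a b => exists u v, wh t (Lam (Lam (App (App (Var 0) u) v)))
                            /\ rep_tree a u /\ rep_tree b v
  end.

#[global] Program Instance Rep_tree : Rep tree := {| rep := rep_tree |}.
Next Obligation. intros [|a b] t Hr; apply Hr. Qed.
Next Obligation.
  intros [|a b] t t' Hb Hs [_ Hr]; split; try assumption.
  - eapply rt1n_trans; eassumption.
  - destruct Hr as [u [v [Hw Hr]]]; exists u, v; split; [eapply rt1n_trans |]; eassumption.
Qed.

Fixpoint rep_list {A} `{Rep A} (l : list A) (t : term) : Prop :=
  bound 0 t /\
  match l with
  | [] => wh t (Lam (Lam (Var 1)))
  | a :: l' => exists u v, wh t (Lam (Lam (App (App (Var 0) u) v)))
                           /\ rep a u /\ rep_list l' v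
  end.

#[global] Program Instance Rep_list A `{Rep A} : Rep (list A) := {| rep := rep_list |}.
Next Obligation. intros A RA [|a b] t Hr; apply Hr. Qed.
Next Obligation.
  intros A RA [|a b] t t' Hb Hs [_ Hr]; split; try assumption.
  - eapply rt1n_trans; eassumption.
  - destruct Hr as [u [v [Hw Hr]]]; exists u, v; split; [eapply rt1n_trans |]; eassumption.
Qed.

Lemma rep_tenc x : rep x (tenc x).
Proof.
  induction x as [| a IHa b IHb]; simpl.
  - repeat split; auto; apply wh_refl.
  - assert (Ha := rep_closed _ _ IHa); assert (Hb := rep_closed _ _ IHb).
    repeat split; try lia; try (eapply bound_mono; [| eassumption]; lia).
    exists (tenc a), (tenc b); split; [apply wh_refl | split; assumption].
Qed.

Ltac closed_tac :=
  repeat match goal with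
  | H : rep _ ?t |- _ =>
      lazymatch goal with
      | _ : bound 0 t |- _ => fail
      | _ => assert (bound 0 t) by exact (rep_closed _ _ H)
      end
  end.

Ltac bnd :=
  closed_tac; simpl;
  repeat split; try lia; auto;
  try (eapply bound_mono; [| eassumption]; lia).

Ltac red1 :=
  match goal with
  | |- wh (App (Lam ?b) ?u) _ => apply wh_beta
  | |- wh (App (App (Lam ?b) ?u) ?v) _ =>
      eapply wh_trans; [apply wh_app, wh_beta, wh_refl |]
  | |- wh (App (App (App (Lam ?b) ?u) ?v) ?w) _ =>
      eapply wh_trans; [apply wh_app, wh_app, wh_beta, wh_refl |]
  | |- wh (App (App (App (App (Lam ?b) ?u) ?v) ?w) ?x) _ =>
      eapply wh_trans; [apply wh_app, wh_app, wh_app, wh_beta, wh_refl |]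
  end.

Ltac simp_closed :=
  simpl;
  repeat match goal with
  | H : bound 0 ?t |- context [lift ?n ?c ?t] =>
      rewrite (lift_bound t 0 n c (Nat.le_0_l _) H)
  | H : bound 0 ?t |- context [subst ?t ?c ?u] =>
      rewrite (subst_bound t 0 c u (Nat.le_0_l _) H)
  end.

Ltac run := closed_tac; repeat (red1; simp_closed); try apply wh_refl.

Definition computable {A} `{Rep A} (x : A) : Prop := exists t, rep x t.

Lemma comp_app {A B} `{Rep A} `{Rep B} (f : A -> B) x :
  computable f -> computable x -> computable (f x).
Proof. intros [t [_ Ht]] [u Hu]; exists (App t u); auto. Qed.

Lemma comp_const {G A} `{Rep G} `{Rep A} (x : A) : computable x -> computable (fun _ : G => x).
Proof.
  intros [t Ht]; exists (Lam t); split; [bnd |].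
  intros a u Hu; apply rep_exp with t; [bnd | | assumption]. run.
Qed.

Lemma comp_id {A} `{Rep A} : computable (fun x : A => x).
Proof.
  exists (Lam (Var 0)); split; [bnd |].
  intros a u Hu; apply rep_exp with u; [bnd | run | assumption].
Qed.

(** The combinator S. With [comp_const] as K and [comp_id] as I it performs bracket abstraction: a
    function body is treated one application at a time. *)
Lemma comp_s {G A B} `{Rep G} `{Rep A} `{Rep B} (f : G -> A -> B) (x : G -> A) :
  computable f -> computable x -> computable (fun g => f g (x g)).
Proof.
  intros [t Ht] [u Hu]; exists (Lam (App (App t (Var 0)) (App u (Var 0)))).
  split; [bnd |].
  intros a v Hv; apply rep_exp with (App (App t v) (App u v)); [bnd | run |].
  destruct Ht as [_ Ht], Hu as [_ Hu]; apply Ht; auto.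
Qed.

(** An abstraction inside the scope of [g] is merged with it into one abstraction over a pair; the
    realizer packs its two arguments into a Scott pair. *)
Lemma comp_lam {G A B} `{Rep G} `{Rep A} `{Rep B} (f : G -> A -> B) :
  computable (fun p : G * A => f (fst p) (snd p)) -> computable f.
Proof.
  intros [t Ht].
  exists (Lam (Lam (App t (Lam (App (App (Var 0) (Var 2)) (Var 1)))))); split; [bnd |].
  intros g u Hu; split; [bnd |]; intros a v Hv.
  apply rep_exp with (App t (Lam (App (App (Var 0) u) v))); [bnd | run |].
  destruct Ht as [_ Ht]; apply (Ht (g, a)).
  split; [bnd |]. eexists; split; [apply wh_refl |]; eauto 6.
Qed.

Lemma comp_ext {A B} `{Rep A} `{Rep B} (f g : A -> B) :
  (forall x, f x = g x) -> computable f -> computable g.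
Proof. intros E; rewrite (functional_extensionality f g E); auto. Qed.

Lemma comp_ext2 {A B C} `{Rep A} `{Rep B} `{Rep C} (f g : A -> B -> C) :
  (forall x y, f x y = g x y) -> computable f -> computable g.
Proof.
  intros E; apply comp_ext; intros x; apply functional_extensionality, E.
Qed.

Lemma comp_true : computable true.
Proof. exists ltrue; split; [bnd |]; eexists; split; [apply wh_refl | reflexivity]. Qed.

Lemma comp_false : computable false.
Proof. exists lfalse; split; [bnd |]; eexists; split; [apply wh_refl | reflexivity]. Qed.

(** A conditional in the form of an application, which bracket abstraction can split, unlike a
    [match]. *)
Definition ite {A} (b : bool) (x y : A) : A := if b then x else y.

Lemma comp_ite {A} `{Rep A} : computable (@ite A).
Proof.
  exists (Lam (Var 0)); split; [bnd |].
  intros b t Ht; split; [bnd |].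
  intros x u Hu; split; [bnd |].
  intros y v Hv; apply rep_exp with (if b then u else v).
  - bnd.
  - closed_tac; destruct Ht as [_ [w [Hw Hv']]]; subst w.
    red1; simp_closed.
    eapply wh_trans; [apply wh_app, wh_app; exact Hw |].
    destruct b; unfold sbool, ltrue, lfalse; run.
  - destruct b; assumption.
Qed.

Lemma comp_pair {A B} `{Rep A} `{Rep B} : computable (@pair A B).
Proof.
  exists (Lam (Lam (Lam (App (App (Var 0) (Var 2)) (Var 1))))); split; [bnd |].
  intros a u Hu; split; [bnd |]; intros b v Hv; split; [bnd |].
  exists (Lam (App (App (Var 0) u) v)); split; [run | eauto].
Qed.

Lemma comp_fst {A B} `{Rep A} `{Rep B} : computable (@fst A B).
Proof.
  exists (Lam (App (Var 0) (Lam (Lam (Var 1))))); split; [bnd |].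
  intros [a b] t Ht; closed_tac.
  destruct Ht as [_ [w [Hw [u [v [-> [Hu Hv]]]]]]]; simpl in Hu, Hv |- *.
  apply rep_exp with u; [bnd | | assumption].
  red1; simp_closed; eapply wh_trans; [apply wh_app; exact Hw | run].
Qed.

Lemma comp_snd {A B} `{Rep A} `{Rep B} : computable (@snd A B).
Proof.
  exists (Lam (App (Var 0) (Lam (Lam (Var 0))))); split; [bnd |].
  intros [a b] t Ht; closed_tac.
  destruct Ht as [_ [w [Hw [u [v [-> [Hu Hv]]]]]]]; simpl in Hu, Hv |- *.
  apply rep_exp with v; [bnd | | assumption].
  red1; simp_closed; eapply wh_trans; [apply wh_app; exact Hw | run].
Qed.

Lemma comp_O : computable O.
Proof. exists (Lam (Lam (Var 1))); split; [bnd | apply wh_refl]. Qed.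

Lemma comp_S : computable S.
Proof.
  exists (Lam (Lam (Lam (App (Var 0) (Var 2))))); split; [bnd |].
  intros n u Hu; split; [bnd |]; exists u; split; [run | exact Hu].
Qed.

Lemma comp_Leaf : computable Leaf.
Proof. exists (Lam (Lam (Var 1))); split; [bnd | apply wh_refl]. Qed.

Lemma comp_nil {A} `{Rep A} : computable (@nil A).
Proof. exists (Lam (Lam (Var 1))); split; [bnd | apply wh_refl]. Qed.

Lemma comp_cons {A} `{Rep A} : computable (@cons A).
Proof.
  exists (Lam (Lam (Lam (Lam (App (App (Var 0) (Var 3)) (Var 2)))))); split; [bnd |].
  intros a u Hu; split; [bnd |]; intros l v Hv; split; [bnd |].
  exists u, v; split; [run | split; assumption].
Qed.

(** * Recursors of the Scott-encoded types *)

Definition nrec {A} (z : A) (s : nat -> A -> A) : nat -> A :=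
  fix f n := match n with O => z | S m => s m (f m) end.

(* [om] is [fun r z s n => n z (fun m => s m (r r z s m))], so that [om om] unfolds to the
   recursor without any fixpoint combinator. *)
Lemma comp_nrec {A} `{Rep A} : computable (@nrec A).
Proof.
  set (om := Lam (Lam (Lam (Lam (App (App (Var 0) (Var 2))
    (Lam (App (App (Var 2) (Var 0))
      (App (App (App (App (Var 4) (Var 4)) (Var 3)) (Var 2)) (Var 0))))))))).
  exists (App om om); split; [bnd |].
  intros z tz Hz; split; [bnd |]; intros s ts Hs; split; [bnd |].
  intros n t Hn; assert (Ht := rep_closed _ _ Hn); closed_tac.
  revert t Hn Ht; induction n as [| n IH]; intros t Hn Ht.
  - apply rep_exp with tz; [bnd | | assumption].
    destruct Hn as [_ Hw].
    unfold om at 1; do 4 (red1; simp_closed).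
    eapply wh_trans; [apply wh_app, wh_app; exact Hw | run].
  - destruct Hn as [_ [u [Hw Hn]]].
    change (rep n u) in Hn; closed_tac.
    apply rep_exp with (App (App ts u) (App (App (App (App om om) tz) ts) u)); [bnd | |].
    + unfold om at 1; do 4 (red1; simp_closed).
      eapply wh_trans; [apply wh_app, wh_app; exact Hw |].
      run.
    + destruct Hs as [_ Hs]; apply Hs; auto.
Qed.

Definition lrec {A B} (z : B) (s : A -> list A -> B -> B) : list A -> B :=
  fix f l := match l with [] => z | a :: l' => s a l' (f l') end.

Lemma comp_lrec {A B} `{Rep A} `{Rep B} : computable (@lrec A B).
Proof.
  set (om := Lam (Lam (Lam (Lam (App (App (Var 0) (Var 2))
    (Lam (Lam (App (App (App (Var 3) (Var 1)) (Var 0))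
      (App (App (App (App (Var 5) (Var 5)) (Var 4)) (Var 3)) (Var 0)))))))))).
  exists (App om om); split; [bnd |].
  intros z tz Hz; split; [bnd |]; intros s ts Hs; split; [bnd |].
  intros l t Hl; assert (Ht := rep_closed _ _ Hl); closed_tac.
  revert t Hl Ht; induction l as [| a l IH]; intros t Hl Ht.
  - apply rep_exp with tz; [bnd | | assumption].
    destruct Hl as [_ Hw].
    unfold om at 1; do 4 (red1; simp_closed).
    eapply wh_trans; [apply wh_app, wh_app; exact Hw | run].
  - destruct Hl as [_ [u [v [Hw [Ha Hl]]]]].
    change (rep l v) in Hl; closed_tac.
    apply rep_exp with
      (App (App (App ts u) v) (App (App (App (App om om) tz) ts) v)); [bnd | |].
    + unfold om at 1; do 4 (red1; simp_closed).
      eapply wh_trans; [apply wh_app, wh_app; exact Hw |].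
      run.
    + destruct Hs as [_ Hs]; apply Hs; auto.
Qed.

Definition trec {A} (z : A) (s : tree -> tree -> A -> A -> A) : tree -> A :=
  fix f x := match x with Leaf => z | Node a b => s a b (f a) (f b) end.

Lemma comp_trec {A} `{Rep A} : computable (@trec A).
Proof.
  set (om := Lam (Lam (Lam (Lam (App (App (Var 0) (Var 2))
    (Lam (Lam (App (App (App (App (Var 3) (Var 1)) (Var 0))
      (App (App (App (App (Var 5) (Var 5)) (Var 4)) (Var 3)) (Var 1)))
      (App (App (App (App (Var 5) (Var 5)) (Var 4)) (Var 3)) (Var 0)))))))))).
  exists (App om om); split; [bnd |].
  intros z tz Hz; split; [bnd |]; intros s ts Hs; split; [bnd |].
  intros x t Hx; assert (Ht := rep_closed _ _ Hx); closed_tac.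
  revert t Hx Ht; induction x as [| a IHa b IHb]; intros t Hx Ht.
  - apply rep_exp with tz; [bnd | | assumption].
    destruct Hx as [_ Hw].
    unfold om at 1; do 4 (red1; simp_closed).
    eapply wh_trans; [apply wh_app, wh_app; exact Hw | run].
  - destruct Hx as [_ [u [v [Hw [Ha Hb]]]]].
    change (rep a u) in Ha; change (rep b v) in Hb; closed_tac.
    apply rep_exp with
      (App (App (App (App ts u) v) (App (App (App (App om om) tz) ts) u))
         (App (App (App (App om om) tz) ts) v)); [bnd | |].
    + unfold om at 1; do 4 (red1; simp_closed).
      eapply wh_trans; [apply wh_app, wh_app; exact Hw |].
      run.
    + destruct Hs as [_ Hs]; apply Hs; auto.
Qed.

(** A realizer of a Boolean head-reduces to exactly [ltrue] or [lfalse]; both are normal for [step],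
    so [evaln] stops there and returns them. *)
Lemma comp_decides (f : tree -> bool) : computable f ->
  exists prog, forall x P, (f x = true <-> P) -> decides_on prog x P.
Proof.
  intros [p [_ Hp]]; exists p; intros x P HP.
  destruct (Hp x (tenc x) (rep_tenc x)) as [_ [v [Hw ->]]].
  destruct (wh_evaln _ _ Hw) as [n Hn]; [destruct (f x); reflexivity |].
  exists n; destruct (f x); [left | right]; split; try assumption.
  - tauto.
  - intros H; apply HP in H; discriminate.
Qed.
(** * A tactic for computability *)

Create HintDb computable discriminated.
#[global] Hint Resolve comp_true comp_false comp_ite comp_pair comp_fst comp_snd comp_O comp_S
  comp_Leaf comp_nil comp_cons comp_nrec comp_lrec comp_trec : comp.

(** Bracket abstraction directed by the goal. Under [fun g], a body that is again an abstraction
    goes to [comp_lam], and a body that is an application is split by [comp_s]; the inner [ltac:]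
    terms inspect the body under its binder. *)
Ltac comp_step :=
  first
  [ solve [auto 1 with comp nocore]
  | lazymatch goal with
    | |- computable (fun g : ?G => @?E g) =>
        first
        [ apply comp_id
        | apply comp_const
        | let b := constr:(fun g : G => ltac:(
            let e := eval cbv beta in (E g) in
            lazymatch e with
            | (fun _ => _) => exact true
            | _ => exact false
            end)) in
          lazymatch b with (fun _ => true) => apply comp_lam; cbv beta end
        | let F := constr:(fun g : G => ltac:(
            let e := eval cbv beta in (E g) in
            lazymatch e with ?f ?x => exact f end)) in
          let X := constr:(fun g : G => ltac:(
            let e := eval cbv beta in (E g) in
            lazymatch e with ?f ?x => exact x end)) in
          apply (comp_s F X) ]
    | |- computable _ => apply comp_app
    end ].

Ltac comp_tac := intros; repeat comp_step.

Lemma comp_pred : computable Nat.pred.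
Proof.
  apply (comp_ext (nrec O (fun m _ => m))); [intros [|n]; reflexivity | comp_tac].
Qed.

Lemma comp_add : computable Nat.add.
Proof.
  apply (comp_ext2 (fun n m => nrec m (fun _ r => S r) n)); [| comp_tac].
  intros n m; induction n; simpl; congruence.
Qed.
#[global] Hint Resolve comp_pred comp_add : comp.

Lemma comp_mul : computable Nat.mul.
Proof.
  apply (comp_ext2 (fun n m => nrec O (fun _ r => Nat.add m r) n)); [| comp_tac].
  intros n m; induction n; simpl; congruence.
Qed.

Lemma comp_sub : computable Nat.sub.
Proof.
  apply (comp_ext2 (fun n m => nrec n (fun _ r => Nat.pred r) m)); [| comp_tac].
  intros n m; induction m; simpl; [lia | rewrite IHm; lia].
Qed.
#[global] Hint Resolve comp_mul comp_sub : comp.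

Lemma comp_leb : computable Nat.leb.
Proof.
  apply (comp_ext2 (fun n m => nrec true (fun _ _ => false) (Nat.sub n m))); [| comp_tac].
  intros n m; destruct (Nat.leb_spec n m).
  - replace (n - m)%nat with O by lia; reflexivity.
  - replace (n - m)%nat with (S (n - m - 1)) by lia; reflexivity.
Qed.
#[global] Hint Resolve comp_leb : comp.

Lemma comp_ltb : computable Nat.ltb.
Proof. unfold Nat.ltb; comp_tac. Qed.

Lemma comp_orb : computable orb.
Proof. apply (comp_ext2 (fun a b => ite a true b)); [intros [] []; reflexivity | comp_tac]. Qed.

Lemma comp_andb : computable andb.
Proof. apply (comp_ext2 (fun a b => ite a b false)); [intros [] []; reflexivity | comp_tac]. Qed.

Lemma comp_negb : computable negb.
Proof. apply (comp_ext (fun a => ite a false true)); [intros []; reflexivity | comp_tac]. Qed.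
#[global] Hint Resolve comp_ltb comp_orb comp_andb comp_negb : comp.

Lemma comp_eqb : computable Nat.eqb.
Proof.
  apply (comp_ext2 (fun n m => andb (Nat.leb n m) (Nat.leb m n))); [| comp_tac].
  intros n m; destruct (Nat.leb_spec n m), (Nat.leb_spec m n), (Nat.eqb_spec n m);
    simpl; try reflexivity; lia.
Qed.
#[global] Hint Resolve comp_eqb : comp.

Section Lists.
Context {A B : Type} `{Rep A} `{Rep B}.

Lemma comp_fold_right : computable (@fold_right B A).
Proof.
  apply (comp_ext2 (fun f z => lrec z (fun a _ r => f a r))); [| comp_tac].
  intros f z; apply functional_extensionality; intros l; induction l; simpl; congruence.
Qed.
Hint Resolve comp_fold_right : comp.

Lemma comp_seq : computable seq.
Proof.
  (* The start changes in the recursive call of [seq], so the recursor builds a function of the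
     start. *)
  apply (comp_ext2 (fun a n => nrec (fun _ => []) (fun _ r k => cons k (r (S k))) n a));
    [| comp_tac].
  intros a n; revert a; induction n; intros a; simpl; [| rewrite IHn]; reflexivity.
Qed.

Lemma comp_app_list : computable (@app A).
Proof.
  apply (comp_ext2 (fun l m => lrec m (fun a _ r => cons a r) l)); [| comp_tac].
  intros l m; induction l; simpl; congruence.
Qed.

Lemma comp_map : computable (@map A B).
Proof.
  apply (comp_ext2 (fun f l => lrec [] (fun a _ r => cons (f a) r) l)); [| comp_tac].
  intros f l; induction l; simpl; congruence.
Qed.

Lemma comp_filter : computable (@filter A).
Proof.
  apply (comp_ext2 (fun f l => lrec [] (fun a _ r => ite (f a) (cons a r) r) l));
    [| comp_tac].
  intros f l; induction l as [|a l IH]; simpl; [reflexivity | rewrite IH].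
  destruct (f a); reflexivity.
Qed.

Lemma comp_forallb : computable (@forallb A).
Proof.
  apply (comp_ext2 (fun f l => lrec true (fun a _ r => andb (f a) r) l)); [| comp_tac].
  intros f l; induction l; simpl; congruence.
Qed.

Lemma comp_existsb : computable (@existsb A).
Proof.
  apply (comp_ext2 (fun f l => lrec false (fun a _ r => orb (f a) r) l)); [| comp_tac].
  intros f l; induction l; simpl; congruence.
Qed.
End Lists.
#[global] Hint Resolve comp_fold_right comp_seq comp_app_list comp_map comp_filter comp_forallb
  comp_existsb : comp.

Lemma comp_flat_map {A B} `{Rep A} `{Rep B} : computable (@flat_map A B).
Proof.
  apply (comp_ext2 (fun f l => lrec [] (fun a _ r => app (f a) r) l)); [| comp_tac].
  intros f l; induction l; simpl; congruence.
Qed.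
#[global] Hint Resolve comp_flat_map : comp.

(** * Fourier-Motzkin elimination *)

(* A monomial [((p, n), v)] stands for [(p - n) x_v]; the variable [x_0] is the constant 1. *)
Definition mono : Type := nat * nat * nat.
Definition lin : Type := list mono.
(* [(true, f)] is the constraint [f > 0] and [(false, f)] is [f >= 0]. *)
Definition con : Type := bool * lin.
Definition dnf : Type := list (list con).

Definition env := nat -> R.

Definition evm (e : env) (m : mono) : R :=
  (INR (fst (fst m)) - INR (snd (fst m))) * e (snd m).
Definition evl (e : env) (f : lin) : R := fold_right (fun m r => evm e m + r) 0 f.
Definition gt0 (s : bool) (x : R) : Prop := if s then 0 < x else 0 <= x.
Definition hcon (e : env) (a : con) : Prop := gt0 (fst a) (evl e (snd a)).
Definition holds (e : env) (d : dnf) : Prop :=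
  exists c, In c d /\ forall a, In a c -> hcon e a.

Definition lneg (f : lin) : lin :=
  map (fun m => (snd (fst m), fst (fst m), snd m)) f.
Definition lscale (k : nat) (f : lin) : lin :=
  map (fun m => (Nat.mul k (fst (fst m)), Nat.mul k (snd (fst m)), snd m)) f.
Definition coefp (x : nat) (f : lin) : nat :=
  fold_right (fun m r => ite (Nat.eqb (snd m) x) (Nat.add (fst (fst m)) r) r) O f.
Definition coefn (x : nat) (f : lin) : nat :=
  fold_right (fun m r => ite (Nat.eqb (snd m) x) (Nat.add (snd (fst m)) r) r) O f.

Definition dtrue : dnf := [[]].
Definition dfalse : dnf := [].
Definition dand (d1 d2 : dnf) : dnf := flat_map (fun c => map (fun c' => app c c') d2) d1.
Definition dor (d1 d2 : dnf) : dnf := app d1 d2.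
Definition dneg (d : dnf) : dnf :=
  fold_right (fun c r => dand (map (fun a => [(negb (fst a), lneg (snd a))]) c) r) dtrue d.

Definition lower (x : nat) (a : con) : bool := Nat.ltb (coefn x (snd a)) (coefp x (snd a)).
Definition upper (x : nat) (a : con) : bool := Nat.ltb (coefp x (snd a)) (coefn x (snd a)).
Definition level (x : nat) (a : con) : bool := Nat.eqb (coefp x (snd a)) (coefn x (snd a)).
(** For a lower bound [a] and an upper bound [b] on [x], each form is multiplied by the absolute
    coefficient of [x] in the other. No division occurs, and the monomials in [x] stay in the list
    with coefficients that cancel. The result is strict as soon as one bound is. *)
Definition resolve (x : nat) (a b : con) : con :=
  (orb (fst a) (fst b),
   app (lscale (Nat.sub (coefn x (snd b)) (coefp x (snd b))) (snd a))
       (lscale (Nat.sub (coefp x (snd a)) (coefn x (snd a))) (snd b))).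
Definition fm (x : nat) (c : list con) : list con :=
  app (filter (level x) c)
      (flat_map (fun a => map (resolve x a) (filter (upper x) c)) (filter (lower x) c)).
Definition dex (x : nat) (d : dnf) : dnf := map (fm x) d.
Definition dall (x : nat) (d : dnf) : dnf := dneg (dex x (dneg d)).

Definition dexs (xs : list nat) (d : dnf) : dnf := fold_right (fun x r => dex x r) d xs.

(* After elimination only the constant [x_0] matters, so the other monomials are dropped. *)
Definition con_true (a : con) : bool :=
  ite (fst a) (Nat.ltb (coefn 0 (snd a)) (coefp 0 (snd a)))
              (Nat.leb (coefn 0 (snd a)) (coefp 0 (snd a))).
Definition dnf_true (d : dnf) : bool := existsb (fun c => forallb con_true c) d.

Lemma comp_lneg : computable lneg.
Proof. unfold lneg; comp_tac. Qed.
Lemma comp_lscale : computable lscale.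
Proof. unfold lscale; comp_tac. Qed.
Lemma comp_coefp : computable coefp.
Proof. unfold coefp; comp_tac. Qed.
Lemma comp_coefn : computable coefn.
Proof. unfold coefn; comp_tac. Qed.
#[global] Hint Resolve comp_lneg comp_lscale comp_coefp comp_coefn : comp.
Lemma comp_dtrue : computable dtrue.
Proof. unfold dtrue; comp_tac. Qed.
Lemma comp_dfalse : computable dfalse.
Proof. unfold dfalse; comp_tac. Qed.
Lemma comp_dand : computable dand.
Proof. unfold dand; comp_tac. Qed.
Lemma comp_dor : computable dor.
Proof. unfold dor; comp_tac. Qed.
#[global] Hint Resolve comp_dtrue comp_dfalse comp_dand comp_dor : comp.
Lemma comp_dneg : computable dneg.
Proof. unfold dneg; comp_tac. Qed.
Lemma comp_lower : computable lower.
Proof. unfold lower; comp_tac. Qed.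
Lemma comp_upper : computable upper.
Proof. unfold upper; comp_tac. Qed.
Lemma comp_level : computable level.
Proof. unfold level; comp_tac. Qed.
Lemma comp_resolve : computable resolve.
Proof. unfold resolve; comp_tac. Qed.
#[global] Hint Resolve comp_dneg comp_lower comp_upper comp_level comp_resolve : comp.
Lemma comp_fm : computable fm.
Proof. unfold fm; comp_tac. Qed.
#[global] Hint Resolve comp_fm : comp.
Lemma comp_dex : computable dex.
Proof. unfold dex; comp_tac. Qed.
#[global] Hint Resolve comp_dex : comp.
Lemma comp_dall : computable dall.
Proof. unfold dall; comp_tac. Qed.
Lemma comp_dexs : computable dexs.
Proof. unfold dexs; comp_tac. Qed.
Lemma comp_dnf_true : computable dnf_true.
Proof. unfold dnf_true, con_true; comp_tac. Qed.
#[global] Hint Resolve comp_dall comp_dexs comp_dnf_true : comp.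

(** * Correctness of the elimination *)

Lemma evl_app e f g : evl e (f ++ g) = evl e f + evl e g.
Proof. induction f as [|m f IH]; simpl; [ring | rewrite IH; ring]. Qed.

Lemma evl_lneg e f : evl e (lneg f) = - evl e f.
Proof. induction f as [|m f IH]; simpl; [ring | rewrite IH; unfold evm; simpl; ring]. Qed.

Lemma evl_lscale e k f : evl e (lscale k f) = INR k * evl e f.
Proof.
  induction f as [|m f IH]; simpl; [ring |].
  rewrite IH; unfold evm; cbn [fst snd]; rewrite !mult_INR; ring.
Qed.

Definition upd (e : env) (x : nat) (r : R) : env := fun y => if Nat.eqb y x then r else e y.

Lemma upd_same e x r : upd e x r x = r.
Proof. unfold upd; rewrite Nat.eqb_refl; reflexivity. Qed.

Lemma upd_other e x r y : y <> x -> upd e x r y = e y.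
Proof. intros H; unfold upd; apply Nat.eqb_neq in H; rewrite H; reflexivity. Qed.

Lemma evl_upd e x r f :
  evl (upd e x r) f = (INR (coefp x f) - INR (coefn x f)) * r + evl (upd e x 0) f.
Proof.
  induction f as [|m f IH]; simpl; [ring |]; rewrite IH.
  unfold evm, upd, ite; destruct (Nat.eqb (snd m) x); rewrite ?plus_INR; ring.
Qed.

Lemma holds_true e : holds e dtrue.
Proof. exists []; split; [left; reflexivity | intros a []]. Qed.

Lemma holds_false e : ~ holds e dfalse.
Proof. intros [c [[] _]]. Qed.

Lemma holds_and e d1 d2 : holds e (dand d1 d2) <-> holds e d1 /\ holds e d2.
Proof.
  unfold holds, dand; split.
  - intros [c [Hc H]]; apply in_flat_map in Hc as [c1 [H1 Hc]].
    apply in_map_iff in Hc as [c2 [<- H2]].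
    split; [exists c1 | exists c2]; split; auto; intros a Ha; apply H, in_app_iff; auto.
  - intros [[c1 [H1 Hc1]] [c2 [H2 Hc2]]]; exists (c1 ++ c2); split.
    + apply in_flat_map; exists c1; split; [assumption |].
      apply in_map_iff; eauto.
    + intros a Ha; apply in_app_iff in Ha as [Ha | Ha]; auto.
Qed.

Lemma holds_or e d1 d2 : holds e (dor d1 d2) <-> holds e d1 \/ holds e d2.
Proof.
  unfold holds, dor; split.
  - intros [c [Hc H]]; apply in_app_iff in Hc as [Hc | Hc]; eauto.
  - intros [[c [Hc H]] | [c [Hc H]]]; exists c; split; auto; apply in_app_iff; auto.
Qed.

Lemma hcon_neg e a : hcon e (negb (fst a), lneg (snd a)) <-> ~ hcon e a.
Proof.
  unfold hcon, gt0; simpl; rewrite evl_lneg; destruct (fst a); simpl; lra.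
Qed.

Lemma holds_neg e d : holds e (dneg d) <-> ~ holds e d.
Proof.
  induction d as [|c d IH]; simpl.
  - split; [intros _ H; exact (holds_false e H) | intros _; apply holds_true].
  - rewrite holds_and, IH; clear IH; split.
    + intros [[c' [Hc' H]] Hd] [c2 [[<- | H2] H2']].
      * apply in_map_iff in Hc' as [a [<- Ha]].
        specialize (H _ (or_introl eq_refl)); apply hcon_neg in H; auto.
      * apply Hd; exists c2; auto.
    + intros H; split.
      * destruct (classic (exists a, In a c /\ ~ hcon e a)) as [[a [Ha Hn]] | Hno].
        -- exists [(negb (fst a), lneg (snd a))]; split.
           ++ apply in_map_iff; eauto.
           ++ intros b [<- | []]; apply hcon_neg; assumption.
        -- exfalso; apply H; exists c; split; [left; reflexivity |].
           intros a Ha; apply NNPP; intros Hn; apply Hno; eauto.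
      * intros [c' [H1 H2]]; apply H; exists c'; split; [right |]; assumption.
Qed.

(* Abstract bounds: [(s, v)] as a lower bound on [r] means [v < r] if [s], [v <= r] otherwise. *)
Lemma dominating_bound (l : list (bool * R)) : l <> [] ->
  exists m, In m l /\ forall r, gt0 (fst m) (r - snd m) ->
    forall b, In b l -> gt0 (fst b) (r - snd b).
Proof.
  induction l as [|b l IH]; [congruence | intros _].
  destruct l as [|b' l].
  - exists b; split; [left; reflexivity |]; intros r Hr c [<- | []]; assumption.
  - destruct IH as [m [Hm H]]; [discriminate |].
    assert (Hc : (forall r, gt0 (fst m) (r - snd m) -> gt0 (fst b) (r - snd b)) \/
                 (forall r, gt0 (fst b) (r - snd b) -> gt0 (fst m) (r - snd m))).
    { destruct b as [s v], m as [s' v']; unfold gt0; simpl.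
      destruct (Rtotal_order v v') as [Hv | [Hv | Hv]].
      - left; intros r; destruct s, s'; lra.
      - destruct s; [right | left]; intros r; destruct s'; lra.
      - right; intros r; destruct s, s'; lra. }
    destruct Hc as [Hc | Hc].
    + exists m; split; [right; assumption |].
      intros r Hr c [<- | Hin]; [apply Hc; assumption | apply H; assumption].
    + exists b; split; [left; reflexivity |].
      intros r Hr c [<- | Hin]; [assumption | apply H; [apply Hc |]; assumption].
Qed.

(** Pairwise compatibility suffices because one lower bound dominates all the others, and likewise
    one upper bound; only this pair has to be separated. *)
Lemma between_bounds (ls us : list (bool * R)) :
  (forall a b, In a ls -> In b us -> gt0 (fst a || fst b) (snd b - snd a)) ->
  exists r, (forall a, In a ls -> gt0 (fst a) (r - snd a)) /\
            (forall b, In b us -> gt0 (fst b) (snd b - r)).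
Proof.
  intros H.
  assert (Hu : us <> [] -> exists m, In m us /\ forall r, gt0 (fst m) (snd m - r) ->
                 forall b, In b us -> gt0 (fst b) (snd b - r)).
  { intros Hu.
    (* Negation turns upper bounds on [r] into lower bounds on [- r]. *)
    destruct (dominating_bound (map (fun b => (fst b, - snd b)) us)) as [m [Hm Hd]].
    - destruct us; [congruence | discriminate].
    - apply in_map_iff in Hm as [m' [<- Hm']]; exists m'; split; [assumption |].
      simpl in Hd; intros r Hr b Hb.
      replace (snd b - r) with (- r - (- snd b)) by ring.
      apply (Hd (- r)) with (b := (fst b, - snd b)).
      + replace (- r - - snd m') with (snd m' - r) by ring; assumption.
      + apply in_map_iff; exists b; auto. }
  destruct ls as [|a0 ls], us as [|b0 us].
  - exists 0; split; intros ? [].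
  - destruct Hu as [m [Hm Hd]]; [discriminate |].
    exists (snd m - 1); split; [intros ? [] |].
    apply Hd; unfold gt0; destruct (fst m); lra.
  - destruct (dominating_bound (a0 :: ls)) as [m [Hm Hd]]; [discriminate |].
    exists (snd m + 1); split; [| intros ? []].
    apply Hd; unfold gt0; destruct (fst m); lra.
  - destruct (dominating_bound (a0 :: ls)) as [m [Hm Hd]]; [discriminate |].
    destruct Hu as [m' [Hm' Hd']]; [discriminate |].
    (* If one of the two dominating bounds is strict, compatibility makes them distinct and the
       midpoint lies strictly between; otherwise the weak inequalities are enough. *)
    exists ((snd m + snd m') / 2); specialize (H _ _ Hm Hm').
    split; [apply Hd | apply Hd'];
      revert H; unfold gt0; destruct (fst m), (fst m'); simpl; lra.
Qed.

Lemma hcon_lower e x a r : lower x a = true ->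
  let k := INR (coefp x (snd a)) - INR (coefn x (snd a)) in
  0 < k /\ (hcon (upd e x r) a <->
            gt0 (fst a) (r - - evl (upd e x 0) (snd a) / k)).
Proof.
  intros H k; apply Nat.ltb_lt, lt_INR in H.
  assert (Hk : 0 < k) by (unfold k; lra); split; [assumption |].
  unfold hcon; rewrite evl_upd; fold k; set (f := evl _ _).
  replace (k * r + f) with (k * (r - - f / k)) by (field; lra).
  set (y := r - - f / k); unfold gt0; destruct (fst a); split; intros; nra.
Qed.

Lemma hcon_upper e x a r : upper x a = true ->
  let k := INR (coefn x (snd a)) - INR (coefp x (snd a)) in
  0 < k /\ (hcon (upd e x r) a <->
            gt0 (fst a) (evl (upd e x 0) (snd a) / k - r)).
Proof.
  intros H k; apply Nat.ltb_lt, lt_INR in H.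
  assert (Hk : 0 < k) by (unfold k; lra); split; [assumption |].
  unfold hcon; rewrite evl_upd; set (f := evl _ _).
  replace ((INR (coefp x (snd a)) - INR (coefn x (snd a))) * r + f)
    with (k * (f / k - r)) by (unfold k in *; field; lra).
  set (y := f / k - r); unfold gt0; destruct (fst a); split; intros; nra.
Qed.

Lemma hcon_level e x a r : level x a = true -> hcon (upd e x r) a <-> hcon e a.
Proof.
  intros H; apply Nat.eqb_eq in H; unfold hcon.
  replace e with (upd e x (e x)) at 2.
  - rewrite evl_upd, (evl_upd e x (e x)), H.
    replace (INR (coefn x (snd a)) - INR (coefn x (snd a))) with 0 by ring.
    rewrite !Rmult_0_l; reflexivity.
  - apply functional_extensionality; intros y; unfold upd.
    destruct (Nat.eqb_spec y x); congruence.
Qed.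

Lemma hcon_resolve e x a b : lower x a = true -> upper x b = true ->
  let ka := INR (coefp x (snd a)) - INR (coefn x (snd a)) in
  let kb := INR (coefn x (snd b)) - INR (coefp x (snd b)) in
  hcon e (resolve x a b) <->
  gt0 (fst a || fst b)
      (evl (upd e x 0) (snd b) / kb - - evl (upd e x 0) (snd a) / ka).
Proof.
  intros Ha Hb ka kb.
  apply Nat.ltb_lt in Ha; apply Nat.ltb_lt in Hb.
  assert (Hka : 0 < ka) by (unfold ka; apply lt_INR in Ha; lra).
  assert (Hkb : 0 < kb) by (unfold kb; apply lt_INR in Hb; lra).
  unfold hcon, resolve; cbn [fst snd].
  rewrite evl_app, !evl_lscale, !minus_INR by lia; fold ka kb.
  (* Written this way, [evl_upd] isolates the terms in [e x], which then cancel. *)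
  replace e with (upd e x (e x)) at 1 2.
  2: { apply functional_extensionality; intros y; unfold upd.
       destruct (Nat.eqb_spec y x); congruence. }
  rewrite (evl_upd e x (e x) (snd a)), (evl_upd e x (e x) (snd b)); fold ka.
  replace (INR (coefp x (snd b)) - INR (coefn x (snd b))) with (- kb) by (unfold kb; ring).
  set (f := evl _ (snd a)); set (g := evl _ (snd b)).
  replace (kb * (ka * e x + f) + ka * (- kb * e x + g)) with ((ka * kb) * (g / kb - - f / ka))
    by (field; lra).
  assert (0 < ka * kb) by nra.
  set (y := g / kb - - f / ka); unfold gt0; destruct (fst a || fst b); split; intros; nra.
Qed.

(** The sign of the total coefficient of [x] sorts the constraints into lower bounds, upper bounds
    and those indifferent to [x]; a value for [x] exists iff each lower bound is compatible with
    each upper bound. *)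
Lemma fm_spec e x c :
  (forall a, In a (fm x c) -> hcon e a) <->
  (exists r, forall a, In a c -> hcon (upd e x r) a).
Proof.
  unfold fm; split.
  - intros H.
    set (fl := fun a : con => (fst a, - evl (upd e x 0) (snd a) /
                 (INR (coefp x (snd a)) - INR (coefn x (snd a))))).
    set (fu := fun a : con => (fst a, evl (upd e x 0) (snd a) /
                 (INR (coefn x (snd a)) - INR (coefp x (snd a))))).
    destruct (between_bounds (map fl (filter (lower x) c)) (map fu (filter (upper x) c)))
      as [r [Hl Hu]].
    + intros a b Ha Hb.
      apply in_map_iff in Ha as [a' [<- Ha]]; apply in_map_iff in Hb as [b' [<- Hb]].
      pose proof (proj2 (proj1 (filter_In _ _ _) Ha)) as Ha'.
      pose proof (proj2 (proj1 (filter_In _ _ _) Hb)) as Hb'.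
      apply (proj1 (hcon_resolve e x a' b' Ha' Hb')), H, in_app_iff; right.
      apply in_flat_map; exists a'; split; [assumption |].
      apply in_map_iff; eauto.
    + exists r; intros a Ha.
      destruct (lower x a) eqn:El; [| destruct (upper x a) eqn:Eu].
      * apply (hcon_lower e x a r El), (Hl (fl a)), in_map, filter_In; auto.
      * apply (hcon_upper e x a r Eu), (Hu (fu a)), in_map, filter_In; auto.
      * assert (Ez : level x a = true).
        { apply Nat.ltb_ge in El, Eu; apply Nat.eqb_eq; lia. }
        apply hcon_level; [assumption |].
        apply H, in_app_iff; left; apply filter_In; auto.
  - intros [r Hr] a Ha; apply in_app_iff in Ha as [Ha | Ha].
    + apply filter_In in Ha as [Ha Ez]; apply (hcon_level e x a r Ez); auto.
    + apply in_flat_map in Ha as [a' [Ha' Ha]]; apply in_map_iff in Ha as [b [<- Hb]].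
      apply filter_In in Ha' as [Ha' El]; apply filter_In in Hb as [Hb Eu].
      apply hcon_resolve; [assumption | assumption |].
      apply Hr in Ha'; apply (hcon_lower e x a' r El) in Ha'.
      apply Hr in Hb; apply (hcon_upper e x b r Eu) in Hb.
      revert Ha' Hb; unfold gt0; destruct (fst a'), (fst b); simpl; lra.
Qed.

Lemma holds_ex e x d : holds e (dex x d) <-> exists r, holds (upd e x r) d.
Proof.
  unfold holds, dex; split.
  - intros [c [Hc H]]; apply in_map_iff in Hc as [c' [<- Hc]].
    apply fm_spec in H as [r Hr]; eauto.
  - intros [r [c [Hc H]]]; exists (fm x c); split; [apply in_map; assumption |].
    apply fm_spec; eauto.
Qed.

Lemma holds_all e x d : holds e (dall x d) <-> forall r, holds (upd e x r) d.
Proof.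
  unfold dall; rewrite holds_neg, holds_ex; split.
  - intros H r; apply NNPP; intros Hn; apply H; exists r; apply holds_neg; assumption.
  - intros H [r Hr]; apply holds_neg in Hr; auto.
Qed.

Lemma holds_exs xs d : forall e, holds e (dexs xs d) <->
  exists e', (forall y, ~ In y xs -> e' y = e y) /\ holds e' d.
Proof.
  induction xs as [|x xs IH]; intros e; simpl.
  - split; [intros H; exists e; auto |].
    intros [e' [He H]]; replace e with e'; [assumption |].
    apply functional_extensionality; auto.
  - rewrite holds_ex; split.
    + intros [r Hr]; apply IH in Hr as [e' [He H]]; exists e'; split; [| assumption].
      intros y Hy; rewrite He by tauto; apply upd_other; intuition.
    + intros [e' [He H]]; exists (e' x); apply IH; exists e'; split; [| assumption].
      intros y Hy; unfold upd; destruct (Nat.eqb_spec y x); [congruence |].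
      apply He; intuition congruence.
Qed.

Definition env0 : env := fun y => if Nat.eqb y 0 then 1 else 0.

Lemma evl_env0 f : evl env0 f = INR (coefp 0 f) - INR (coefn 0 f).
Proof.
  induction f as [|m f IH]; simpl; [ring |]; rewrite IH.
  unfold evm, env0, ite; destruct (Nat.eqb (snd m) 0); rewrite ?plus_INR; ring.
Qed.

(** Truth is tested at the single environment [env0], to which [holds_exs] and [holds_all] tie the
    meaning of the quantifiers; any other variable left in the formula reads 0 there. *)
Lemma dnf_true_spec d : dnf_true d = true <-> holds env0 d.
Proof.
  assert (Hc : forall a, con_true a = true <-> hcon env0 a).
  { intros a; unfold con_true, hcon, gt0, ite; rewrite evl_env0.
    destruct (fst a); rewrite ?Nat.ltb_lt, ?Nat.leb_le; split; intros H.
    - apply lt_INR in H; lra.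
    - apply INR_lt; lra.
    - apply le_INR in H; lra.
    - apply INR_le; lra. }
  unfold dnf_true; rewrite existsb_exists; unfold holds.
  split; intros [c [Hin H]]; exists c; (split; [assumption |]).
  - rewrite forallb_forall in H; intros a Ha; apply Hc; auto.
  - apply forallb_forall; intros a Ha; apply Hc; auto.
Qed.

(** * Symbolic traversal of a path *)

Definition tfst : tree -> tree := trec Leaf (fun a _ _ _ => a).
Definition tsnd : tree -> tree := trec Leaf (fun _ b _ _ => b).
Definition isleaf : tree -> bool := trec true (fun _ _ _ _ => false).
Definition tfold {A} (f : tree -> A -> A) (z : A) : tree -> A := trec z (fun a _ _ r => f a r).
Definition tnat : tree -> nat := tfold (fun _ n => S n) O.
Definition tpos : tree -> nat :=
  trec (S O) (fun a _ _ r => ite (isleaf a) (Nat.add r r) (S (Nat.add r r))).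
(** [zpos] and [zneg] split an integer into a difference of naturals, the form of coefficient that
    [mono] uses. *)
Definition zpos : tree -> nat := trec O (fun a b _ _ => ite (isleaf a) (tpos b) O).
Definition zneg : tree -> nat := trec O (fun a b _ _ => ite (isleaf a) O (tpos b)).

Lemma comp_tfst : computable tfst.
Proof. unfold tfst; comp_tac. Qed.
Lemma comp_tsnd : computable tsnd.
Proof. unfold tsnd; comp_tac. Qed.
Lemma comp_isleaf : computable isleaf.
Proof. unfold isleaf; comp_tac. Qed.
Lemma comp_tfold {A} `{Rep A} : computable (@tfold A).
Proof. unfold tfold; comp_tac. Qed.
#[global] Hint Resolve comp_tfst comp_tsnd comp_isleaf comp_tfold : comp.
Lemma comp_tnat : computable tnat.
Proof. unfold tnat; comp_tac. Qed.
Lemma comp_tpos : computable tpos.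
Proof. unfold tpos; comp_tac. Qed.
#[global] Hint Resolve comp_tnat comp_tpos : comp.
Lemma comp_zpos : computable zpos.
Proof. unfold zpos; comp_tac. Qed.
Lemma comp_zneg : computable zneg.
Proof. unfold zneg; comp_tac. Qed.
#[global] Hint Resolve comp_zpos comp_zneg : comp.

Lemma tfold_encL {X A} (enc : X -> tree) (f : tree -> A -> A) z l :
  tfold f z (encL enc l) = fold_right (fun x r => f (enc x) r) z l.
Proof. induction l as [|x l IH]; simpl; [| rewrite <- IH]; reflexivity. Qed.

Lemma tnat_encN n : tnat (encN n) = n.
Proof. induction n; simpl; [| unfold tnat, tfold in *; simpl; rewrite IHn]; reflexivity. Qed.

Lemma tpos_encP p : tpos (encP p) = Pos.to_nat p.
Proof.
  induction p as [p IH | p IH |]; [| | reflexivity].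
  - change (S (tpos (encP p) + tpos (encP p)) = Pos.to_nat p~1); rewrite IH; lia.
  - change (tpos (encP p) + tpos (encP p) = Pos.to_nat p~0)%nat; rewrite IH; lia.
Qed.

Lemma z_encZ z : INR (zpos (encZ z)) - INR (zneg (encZ z)) = IZR z.
Proof.
  destruct z as [| p | p].
  - unfold zpos, zneg; simpl; ring.
  - change (INR (tpos (encP p)) - 0 = IZR (Z.pos p)).
    rewrite tpos_encP, INR_IPR; unfold IZR; ring.
  - change (0 - INR (tpos (encP p)) = IZR (Z.neg p)).
    rewrite tpos_encP, INR_IPR; unfold IZR; ring.
Qed.

(* [(f, c)] stands for the rational linear form [f / (c + 1)]. *)
Definition qlin : Type := lin * nat.
Definition evq (e : env) (q : qlin) : R := evl e (fst q) / INR (S (snd q)).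

(** Since [x_0] stands for 1, the case [v = O] yields the constant [q]. *)
Definition qmul (q : tree) (v : nat) : qlin :=
  ([(zpos (tfst q), zneg (tfst q), v)], Nat.pred (tpos (tsnd q))).
Definition qadd (f g : qlin) : qlin :=
  (app (lscale (S (snd g)) (fst f)) (lscale (S (snd f)) (fst g)),
   Nat.pred (Nat.mul (S (snd f)) (S (snd g)))).
Definition qneg (f : qlin) : qlin := (lneg (fst f), snd f).
Definition qvar (v : nat) : qlin := ([(S O, O, v)], O).
Definition qzero : qlin := ([], O).
(** Only the numerator of [g - f] is kept, as the denominator [c + 1] is positive. *)
Definition qcmp (s : bool) (f g : qlin) : dnf := [[(s, fst (qadd g (qneg f)))]].

Lemma comp_qmul : computable qmul.
Proof. unfold qmul; comp_tac. Qed.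
Lemma comp_qadd : computable qadd.
Proof. unfold qadd; comp_tac. Qed.
Lemma comp_qneg : computable qneg.
Proof. unfold qneg; comp_tac. Qed.
Lemma comp_qvar : computable qvar.
Proof. unfold qvar; comp_tac. Qed.
Lemma comp_qzero : computable qzero.
Proof. unfold qzero; comp_tac. Qed.
#[global] Hint Resolve comp_qmul comp_qadd comp_qneg comp_qvar comp_qzero : comp.
Lemma comp_qcmp : computable qcmp.
Proof. unfold qcmp; comp_tac. Qed.
#[global] Hint Resolve comp_qcmp : comp.

Lemma INR_S_pos n : 0 < INR (S n).
Proof. apply lt_0_INR; lia. Qed.

Lemma evq_mul e q v : evq e (qmul (encQ q) v) = Q2R q * e v.
Proof.
  unfold evq, qmul; cbn [fst snd encQ tfst tsnd trec evl fold_right].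
  unfold evm; cbn [fst snd]; rewrite z_encZ, tpos_encP.
  assert (H := Pos2Nat.is_pos (Qden q)).
  replace (S (Nat.pred (Pos.to_nat (Qden q)))) with (Pos.to_nat (Qden q)) by lia.
  rewrite INR_IPR; change (IPR (Qden q)) with (IZR (Z.pos (Qden q))).
  unfold Q2R, Rdiv; ring.
Qed.

Lemma evq_add e f g : evq e (qadd f g) = evq e f + evq e g.
Proof.
  unfold evq, qadd; cbn [fst snd]; rewrite evl_app, !evl_lscale.
  replace (S (Nat.pred (S (snd f) * S (snd g)))) with (S (snd f) * S (snd g))%nat by lia.
  rewrite mult_INR; assert (H1 := INR_S_pos (snd f)); assert (H2 := INR_S_pos (snd g)).
  field; lra.
Qed.

Lemma evq_neg e f : evq e (qneg f) = - evq e f.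
Proof.
  unfold evq, qneg; cbn [fst snd]; rewrite evl_lneg; unfold Rdiv; ring.
Qed.

Lemma evq_var e v : evq e (qvar v) = e v.
Proof. unfold evq, qvar, evm; simpl; unfold evm; simpl; field. Qed.

Lemma evq_zero e : evq e qzero = 0.
Proof. unfold evq; simpl; field. Qed.

Lemma holds_cmp e s f g : holds e (qcmp s f g) <-> gt0 s (evq e g - evq e f).
Proof.
  assert (Hq : holds e (qcmp s f g) <-> hcon e (s, fst (qadd g (qneg f)))).
  { unfold holds, qcmp; split.
    - intros [c [[<- | []] H]]; apply H; left; reflexivity.
    - intros H; eexists; split; [left; reflexivity |]; intros a [<- | []]; assumption. }
  rewrite Hq; unfold Rminus; rewrite <- evq_neg, <- evq_add; unfold evq, hcon.
  set (q := qadd g (qneg f)); cbn [fst snd].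
  assert (H := INR_S_pos (snd q)).
  replace (evl e (fst q)) with (INR (S (snd q)) * (evl e (fst q) / INR (S (snd q))))
    at 1 by (field; lra).
  set (y := evl e (fst q) / INR (S (snd q))).
  unfold gt0; destruct s; split; intros; nra.
Qed.

Definition agree (j : nat) (e e' : env) : Prop := forall i, (i < j)%nat -> e i = e' i.
(** Freshness of [x_j] and all later variables, stated semantically because cancelled monomials may
    remain in a form. *)
Definition below (j : nat) (q : qlin) : Prop :=
  forall e e', agree j e e' -> evq e q = evq e' q.

Lemma agree_mono j j' e e' : (j' <= j)%nat -> agree j e e' -> agree j' e e'.
Proof. intros H Ha i Hi; apply Ha; lia. Qed.

Lemma agree_upd j e r : agree j e (upd e j r).
Proof. intros i Hi; rewrite upd_other; [reflexivity | lia]. Qed.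

Lemma below_mono j j' q : (j <= j')%nat -> below j q -> below j' q.
Proof. intros H Hb e e' Ha; apply Hb; eapply agree_mono; eassumption. Qed.

Lemma below_add j f g : below j f -> below j g -> below j (qadd f g).
Proof. intros Hf Hg e e' Ha; rewrite !evq_add, (Hf e e' Ha), (Hg e e' Ha); reflexivity. Qed.

Lemma below_neg j f : below j f -> below j (qneg f).
Proof. intros Hf e e' Ha; rewrite !evq_neg, (Hf e e' Ha); reflexivity. Qed.

Lemma below_var j v : (v < j)%nat -> below j (qvar v).
Proof. intros H e e' Ha; rewrite !evq_var; apply Ha, H. Qed.

Lemma below_mul j q v : (v < j)%nat -> below j (qmul (encQ q) v).
Proof. intros H e e' Ha; rewrite !evq_mul, (Ha v H); reflexivity. Qed.

Lemma below_zero j : below j qzero.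
Proof. intros e e' _; rewrite !evq_zero; reflexivity. Qed.

Definition deq (f g : qlin) : dnf := dand (qcmp false f g) (qcmp false g f).

Lemma holds_eq e f g : holds e (deq f g) <-> evq e f = evq e g.
Proof. unfold deq; rewrite holds_and, !holds_cmp; unfold gt0; lra. Qed.

Definition atomF (v : nat -> qlin) (a : tree) : dnf :=
  ite (isleaf (tfst (tsnd a)))
      (qcmp false (v (tnat (tfst a))) (qmul (tsnd (tsnd a)) O))
      (ite (isleaf (tsnd (tfst (tsnd a))))
           (qcmp false (qmul (tsnd (tsnd a)) O) (v (tnat (tfst a))))
           (deq (v (tnat (tfst a))) (qmul (tsnd (tsnd a)) O))).
Definition satF (v : nat -> qlin) (g : tree) : dnf :=
  tfold (fun a r => dand (atomF v a) r) dtrue g.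
(** A clock is the sum of the delays since its last reset, so clock values remain linear forms in
    the delay variables. *)
Definition delayF (v : nat -> qlin) (j : nat) : nat -> qlin := fun x => qadd (v x) (qvar j).
Definition resetF (v : nat -> qlin) (z : tree) : nat -> qlin :=
  fun x => ite (tfold (fun a r => orb (Nat.eqb x (tnat a)) r) false z) qzero (v x).
Definition zerosF (n : nat) (v : nat -> qlin) : dnf :=
  fold_right (fun x r => dand (deq (v x) qzero) r) dtrue (seq O n).

(* [a1], [b1] bound the energy after the delay [x_j], and [a2], [b2] after the update of [t]. *)
Definition coreF (E : qlin -> qlin -> dnf) (j : nat) (l t : tree) (v : nat -> qlin)
    (a1 b1 a2 b2 : qlin) (k : qlin -> qlin -> dnf) : dnf :=
  dex j (dand (qcmp false qzero (qvar j))
        (dand (satF v (tfst l))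
        (dand (satF (delayF v j) (tfst l))
        (dand (satF (delayF v j) (tfst t))
        (dand (E a1 b1) (dand (E a2 b2) (k a2 b2))))))).
(** [g] fixes the sign of the uncertainty here and in [jumpF]: [qneg] follows the lower end of the
    energy interval, [idq] the upper end. *)
Definition slopeF (g : qlin -> qlin) (j : nat) (l : tree) (a : qlin) : qlin :=
  qadd a (qadd (qmul (tfst (tsnd l)) j) (g (qmul (tsnd (tsnd l)) j))).
Definition jumpF (g : qlin -> qlin) (t : tree) (a : qlin) : qlin :=
  qadd a (qadd (qmul (tfst (tsnd t)) O) (g (qmul (tfst (tsnd (tsnd t))) O))).
Definition idq (q : qlin) : qlin := q.
(** The fold runs from the end of the path, so it returns a function of the traversal state:
    symbolic clocks, next free variable and both energy ends. The quantifiers over the delays are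
    thereby nested in the order of the path. *)
Definition pathF (n : nat) (E K : qlin -> qlin -> dnf) (st : tree) :
    (nat -> qlin) -> nat -> qlin -> qlin -> dnf :=
  tfold (fun lt k v j a b =>
      coreF E j (tfst lt) (tsnd lt) v
        (slopeF qneg j (tfst lt) a) (slopeF idq j (tfst lt) b)
        (jumpF qneg (tsnd lt) (slopeF qneg j (tfst lt) a))
        (jumpF idq (tsnd lt) (slopeF idq j (tfst lt) b))
        (k (resetF (delayF v j) (tsnd (tsnd (tsnd (tsnd lt))))) (S j)))
    (fun v _ a b => dand (zerosF n v) (K a b)) st.

Lemma comp_deq : computable deq.
Proof. unfold deq; comp_tac. Qed.
#[global] Hint Resolve comp_deq : comp.
Lemma comp_atomF : computable atomF.
Proof. unfold atomF; comp_tac. Qed.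
#[global] Hint Resolve comp_atomF : comp.
Lemma comp_satF : computable satF.
Proof. unfold satF; comp_tac. Qed.
Lemma comp_delayF : computable delayF.
Proof. unfold delayF; comp_tac. Qed.
Lemma comp_resetF : computable resetF.
Proof. unfold resetF; comp_tac. Qed.
Lemma comp_zerosF : computable zerosF.
Proof. unfold zerosF; comp_tac. Qed.
#[global] Hint Resolve comp_satF comp_delayF comp_resetF comp_zerosF : comp.
Lemma comp_coreF : computable coreF.
Proof. unfold coreF; comp_tac. Qed.
Lemma comp_slopeF : computable slopeF.
Proof. unfold slopeF; comp_tac. Qed.
Lemma comp_jumpF : computable jumpF.
Proof. unfold jumpF; comp_tac. Qed.
Lemma comp_idq : computable idq.
Proof. apply comp_id. Qed.
#[global] Hint Resolve comp_coreF comp_slopeF comp_jumpF comp_idq : comp.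
Lemma comp_pathF : computable pathF.
Proof. unfold pathF; comp_tac. Qed.
#[global] Hint Resolve comp_pathF : comp.

(** * Meaning of the symbolic traversal *)

Definition val (e : env) (v : nat -> qlin) : valuation := fun x => evq e (v x).

Lemma holds_atom e v a : e O = 1 -> holds e (atomF v (encAtom a)) <-> atom_sat (val e v) a.
Proof.
  intros He; unfold atomF, atom_sat, val, ite.
  destruct a as [x op c]; destruct op; cbn [encAtom encCmp a_clk a_op a_c tfst tsnd trec isleaf];
    rewrite tnat_encN, ?holds_eq, ?holds_cmp, ?evq_mul, ?He, ?Rmult_1_r; unfold gt0; lra.
Qed.

Lemma holds_sat e v g : e O = 1 -> holds e (satF v (encL encAtom g)) <-> sat (val e v) g.
Proof.
  intros He; unfold satF, sat; rewrite tfold_encL; induction g as [|a g IH]; simpl.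
  - split; [constructor | intros; apply holds_true].
  - rewrite holds_and, holds_atom, IH by assumption; split.
    + intros []; constructor; assumption.
    + inversion 1; auto.
Qed.

Lemma val_delay e v j : val e (delayF v j) = vdelay (val e v) (e j).
Proof.
  apply functional_extensionality; intros x; unfold val, delayF, vdelay.
  rewrite evq_add, evq_var; reflexivity.
Qed.

Lemma val_reset e v z : val e (resetF v (encL encN z)) = vreset (val e v) z.
Proof.
  apply functional_extensionality; intros x; unfold val, resetF, vreset, ite.
  rewrite tfold_encL.
  replace (fold_right (fun y r => (x =? tnat (encN y))%nat || r) false z)
    with (existsb (Nat.eqb x) z).
  - destruct (existsb (Nat.eqb x) z); [apply evq_zero | reflexivity].
  - induction z as [|y z IH]; simpl; [| rewrite tnat_encN, IH]; reflexivity.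
Qed.

Lemma holds_big_and {X} e (f : X -> dnf) l :
  holds e (fold_right (fun x r => dand (f x) r) dtrue l) <-> forall x, In x l -> holds e (f x).
Proof.
  induction l as [|x l IH]; simpl.
  - split; [intros _ x [] | intros _; apply holds_true].
  - rewrite holds_and, IH; split.
    + intros [H1 H2] y [<- | Hy]; auto.
    + intros H; split; auto.
Qed.

Lemma holds_big_or {X} e (f : X -> dnf) l :
  holds e (fold_right (fun x r => dor (f x) r) dfalse l) <-> exists x, In x l /\ holds e (f x).
Proof.
  induction l as [|x l IH]; simpl.
  - split; [intros H; destruct (holds_false _ H) | intros [x [[] _]]].
  - rewrite holds_or, IH; split.
    + intros [H | [y [Hy H]]]; eauto.
    + intros [y [[<- | Hy] H]]; eauto.
Qed.

Lemma holds_zeros e n v :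
  holds e (zerosF n v) <-> forall x, (x < n)%nat -> val e v x = 0.
Proof.
  unfold zerosF; rewrite holds_big_and; split; intros H x Hx.
  - specialize (H x); rewrite in_seq, holds_eq, evq_zero in H; apply H; lia.
  - rewrite in_seq in Hx; rewrite holds_eq, evq_zero; apply H; lia.
Qed.

(* Propagates the interval [[a, b]] of possible energies along a path; [EP] is required after
   every half-step and [KP] at the end. *)
Fixpoint energies (EP KP : R -> R -> Prop) (st : list (loc * trans)) (ds : list R) (a b : R) :
    Prop :=
  match st, ds with
  | [], [] => KP a b
  | (l, t) :: st', d :: ds' =>
      let a1 := a + d * (Q2R (l_rate l) - Q2R (l_eps l)) in
      let b1 := b + d * (Q2R (l_rate l) + Q2R (l_eps l)) in
      let a2 := a1 + (Q2R (t_upd t) - Q2R (t_delta t)) in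
      let b2 := b1 + (Q2R (t_upd t) + Q2R (t_delta t)) in
      EP a1 b1 /\ EP a2 b2 /\ energies EP KP st' ds' a2 b2
  | _, _ => False
  end.

Definition enc_step (lt : loc * trans) : tree := Node (encLoc (fst lt)) (encTrans (snd lt)).

(** The environments agreeing below [j] cover every later assignment of delay variables, so the
    property passes under their quantifiers. *)
Definition expresses (e : env) (j : nat) (F : qlin -> qlin -> dnf) (P : R -> R -> Prop) : Prop :=
  forall e' a b, agree j e e' -> holds e' (F a b) <-> P (evq e' a) (evq e' b).

Lemma expresses_mono e e' j j' F P : (j <= j')%nat -> agree j e e' ->
  expresses e j F P -> expresses e' j' F P.
Proof.
  intros Hj Ha H e2 a b He; apply H; intros i Hi; rewrite Ha by assumption.
  apply He; lia.
Qed.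

(** Each [dex j] contributes one entry of [ds]. The [below] hypotheses prevent capture: choosing
    [x_j] changes neither the clocks nor the energies accumulated so far. *)
Lemma holds_path n E K EP KP st : forall e v j a b, (1 <= j)%nat -> e O = 1 ->
  (forall x, below j (v x)) -> below j a -> below j b ->
  expresses e j E EP -> expresses e j K KP ->
  (holds e (pathF n E K (encL enc_step st) v j a b) <->
   exists ds, clock_ok n (val e v) st ds /\ energies EP KP st ds (evq e a) (evq e b)).
Proof.
  unfold pathF; rewrite tfold_encL.
  induction st as [|[l t] st IH]; intros e v j a b Hj He Hv Ha Hb HE HK.
  - cbn [fold_right]; rewrite holds_and, holds_zeros, (HK e a b) by (intros i _; reflexivity).
    split.
    + intros [H1 H2]; exists []; split; assumption.
    + intros [[|d ds] [H1 H2]]; [split; assumption | destruct H1].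
  - cbn [fold_right]; set (rec := fold_right _ _ _) in *; unfold coreF at 1; rewrite holds_ex.
    assert (Hstep : forall d : R,
      let e1 := upd e j d in
      let a1 := slopeF qneg j (encLoc l) a in
      let b1 := slopeF idq j (encLoc l) b in
      let a2 := jumpF qneg (encTrans t) a1 in
      let b2 := jumpF idq (encTrans t) b1 in
      (0 <= d /\ sat (val e v) (l_inv l) /\ sat (vdelay (val e v) d) (l_inv l) /\
       sat (vdelay (val e v) d) (t_guard t) /\ EP (evq e1 a1) (evq e1 b1) /\
       EP (evq e1 a2) (evq e1 b2) /\
       exists ds, clock_ok n (vreset (vdelay (val e v) d) (t_reset t)) st ds /\
                  energies EP KP st ds (evq e1 a2) (evq e1 b2))
      <-> holds e1 (dand (qcmp false qzero (qvar j))
        (dand (satF v (encL encAtom (l_inv l)))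
        (dand (satF (delayF v j) (encL encAtom (l_inv l)))
        (dand (satF (delayF v j) (encL encAtom (t_guard t)))
        (dand (E a1 b1) (dand (E a2 b2)
          (rec (resetF (delayF v j) (encL encN (t_reset t))) (S j) a2 b2)))))))).
    { intros d e1 a1 b1 a2 b2.
      assert (Hag : agree j e e1) by apply agree_upd.
      assert (He1 : e1 O = 1) by (unfold e1; rewrite upd_other; [assumption | lia]).
      assert (Hvv : val e v = val e1 v).
      { apply functional_extensionality; intros x; apply Hv; assumption. }
      assert (Hd : e1 j = d) by apply upd_same.
      assert (Hba : forall q, below j q -> below (S j) q)
        by (intros q; apply below_mono; lia).
      rewrite !holds_and, !holds_sat by assumption.
      rewrite val_delay, Hd, <- Hvv, holds_cmp, evq_var, evq_zero, Hd.
      rewrite (HE e1 a1 b1), (HE e1 a2 b2) by assumption.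
      rewrite IH.
      - rewrite val_reset, val_delay, Hd, <- Hvv; unfold gt0, Rminus.
        rewrite Ropp_0, Rplus_0_r; tauto.
      - lia.
      - assumption.
      - intros x; unfold resetF, ite; destruct (tfold _ _ _); [apply below_zero |].
        apply below_add; [apply Hba, Hv | apply below_var; lia].
      - apply below_add; [| apply below_add; [| apply below_neg]; apply below_mul; lia].
        apply below_add; [apply Hba, Ha |].
        apply below_add; [| apply below_neg]; apply below_mul; lia.
      - apply below_add; [| apply below_add; apply below_mul; lia].
        apply below_add; [apply Hba, Hb |].
        apply below_add; apply below_mul; lia.
      - eapply expresses_mono; [| exact Hag | exact HE]; lia.
      - eapply expresses_mono; [| exact Hag | exact HK]; lia. }
    assert (Hev : forall d, let e1 := upd e j d in
      let a1 := slopeF qneg j (encLoc l) a in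
      let b1 := slopeF idq j (encLoc l) b in
      evq e1 a1 = evq e a + d * (Q2R (l_rate l) - Q2R (l_eps l)) /\
      evq e1 b1 = evq e b + d * (Q2R (l_rate l) + Q2R (l_eps l)) /\
      evq e1 (jumpF qneg (encTrans t) a1) =
        evq e1 a1 + (Q2R (t_upd t) - Q2R (t_delta t)) /\
      evq e1 (jumpF idq (encTrans t) b1) =
        evq e1 b1 + (Q2R (t_upd t) + Q2R (t_delta t))).
    { intros d e1 a1 b1.
      assert (Hag : agree j e e1) by apply agree_upd.
      assert (He1 : e1 O = 1) by (unfold e1; rewrite upd_other; [assumption | lia]).
      assert (Hd : e1 j = d) by apply upd_same.
      unfold a1, b1, slopeF, jumpF, idq; cbn [encLoc encTrans tfst tsnd trec].
      rewrite !evq_add, !evq_neg, !evq_mul.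
      rewrite Hd, He1, (Ha e e1 Hag), (Hb e e1 Hag); repeat split; ring. }
    split.
    + intros [d Hd]; apply (proj2 (Hstep d)) in Hd.
      destruct (Hev d) as [E1 [E2 [E3 E4]]]; rewrite E3, E4, E1, E2 in Hd.
      destruct Hd as (H1 & H2 & H3 & H4 & H5 & H6 & ds & H7 & H8).
      exists (d :: ds); simpl; tauto.
    + intros [[|d ds] [H1 H2]]; [destruct H1 |].
      exists d; apply (proj1 (Hstep d)).
      destruct (Hev d) as [E1 [E2 [E3 E4]]]; rewrite E3, E4, E1, E2.
      simpl in H1, H2; destruct H1 as (H1 & H1a & H1b & H1c & H1d).
      destruct H2 as (H2 & H2a & H2b).
      repeat (split; [assumption |]); exists ds; split; assumption.
Qed.

(** * The decision procedure *)

(* The interval with end points [l] and [u]; [l] belongs to it iff [fl > 0], [u] iff [fu > 0]. *)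
Definition in_itv (l u fl fu x : R) : Prop :=
  (l < x \/ l <= x /\ 0 < fl) /\ (x < u \/ x <= u /\ 0 < fu).
Definition itv (e : env) (v : nat) : R -> Prop :=
  in_itv (e v) (e (S v)) (e (S (S v))) (e (S (S (S v)))).

Definition memF (v : nat) (q : qlin) : dnf :=
  dand (dor (qcmp true (qvar v) q)
            (dand (qcmp false (qvar v) q) (qcmp true qzero (qvar (S (S v))))))
       (dor (qcmp true q (qvar (S v)))
            (dand (qcmp false q (qvar (S v))) (qcmp true qzero (qvar (S (S (S v))))))).
(* First of the four variables describing the [k]-th of the [N] intervals of macro-state [s]. *)
Definition base (N s k : nat) : nat := S (Nat.mul 4 (Nat.add k (Nat.mul N s))).
Definition inEF (lo hi : tree) (a b : qlin) : dnf :=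
  dand (qcmp false (qmul lo O) a) (qcmp false b (qmul hi O)).
Definition targetF (N s : nat) (a b : qlin) : dnf :=
  fold_right (fun k r => dor (dand (memF (base N s k) a) (memF (base N s k) b)) r) dfalse
    (seq O N).

Definition edgesF (f : tree -> tree -> dnf) (ed : tree) (s : nat) : dnf :=
  tfold (fun e r => dor (ite (Nat.eqb (tnat (tfst (tfst e))) s)
                             (f (tsnd (tfst e)) (tsnd e)) dfalse) r) dfalse ed.
Definition preF (ed : tree) (N : nat) (lo hi : tree) (j : nat) (w : qlin) (s : nat) : dnf :=
  edgesF (fun s' p =>
    pathF (tnat (tfst p)) (inEF lo hi) (targetF N (tnat s')) (tfst (tsnd p))
      (fun _ => qzero) j w w) ed s.
(** [valid_strategy] asks for legal delays at every macro-configuration, also where no safe move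
    exists; hence the traversal with trivial energy conditions. *)
Definition validF (ed : tree) (s : nat) : dnf :=
  edgesF (fun _ p =>
    pathF (tnat (tfst p)) (fun _ _ => dtrue) (fun _ _ => dtrue) (tfst (tsnd p))
      (fun _ => qzero) (S O) qzero qzero) ed s.

Definition forallF (f : nat -> dnf) (n : nat) : dnf :=
  fold_right (fun x r => dand (f x) r) dtrue (seq O n).

(** [j] is meant to be the first variable beyond those of the intervals. Under [dall j] it carries
    the energy, so the delays there begin at [S j]. *)
Definition goodF (ed : tree) (n N : nat) (lo hi : tree) (s0 : nat) (w0 : tree) (j : nat) : dnf :=
  dand (inEF lo hi (qmul w0 O) (qmul w0 O))
  (dand (preF ed N lo hi j (qmul w0 O) s0)
   (forallF (fun s => forallF (fun k =>
      dall j (dor (dneg (memF (base N s k) (qvar j))) (preF ed N lo hi (S j) (qvar j) s))) N) n)).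
Definition winF (ed : tree) (n N : nat) (lo hi : tree) (s0 : nat) (w0 : tree) : dnf :=
  dand (forallF (validF ed) n)
       (dexs (seq (S O) (Nat.mul 4 (Nat.mul N n))) (goodF ed n N lo hi s0 w0 (base N n O))).

(** The number [M]: the sum dominates each single denominator, and the successor keeps it positive
    when there are no edges. *)
Definition den_sum (ed : tree) : nat :=
  S (tfold (fun e r => Nat.add (tfold (fun lt r' =>
       Nat.add (tpos (tsnd (tfst (tsnd (tsnd (tsnd lt)))))) r') O (tfst (tsnd (tsnd e)))) r) O ed).
Definition qabs (q : tree) : nat := Nat.add (zpos (tfst q)) (zneg (tfst q)).
(** [qabs] is the absolute numerator, which bounds the rational itself; so [M * (qabs hi + qabs lo)]
    bounds the index of every grid point in [E], and the successor counts index 0. *)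
Definition itv_count (ed lo hi : tree) : nat :=
  S (Nat.mul (den_sum ed) (Nat.add (qabs hi) (qabs lo))).

Definition decide (x : tree) : bool :=
  dnf_true
    (winF (tsnd (tfst x)) (tnat (tfst (tfst x)))
       (itv_count (tsnd (tfst x)) (tfst (tfst (tsnd x))) (tsnd (tfst (tsnd x))))
       (tfst (tfst (tsnd x))) (tsnd (tfst (tsnd x)))
       (tnat (tfst (tsnd (tsnd x)))) (tsnd (tsnd (tsnd x)))).

Lemma comp_memF : computable memF.
Proof. unfold memF; comp_tac. Qed.
Lemma comp_base : computable base.
Proof. unfold base; comp_tac. Qed.
Lemma comp_inEF : computable inEF.
Proof. unfold inEF; comp_tac. Qed.
#[global] Hint Resolve comp_memF comp_base comp_inEF : comp.
Lemma comp_targetF : computable targetF.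
Proof. unfold targetF; comp_tac. Qed.
Lemma comp_edgesF : computable edgesF.
Proof. unfold edgesF; comp_tac. Qed.
#[global] Hint Resolve comp_targetF comp_edgesF : comp.
Lemma comp_preF : computable preF.
Proof. unfold preF; comp_tac. Qed.
Lemma comp_validF : computable validF.
Proof. unfold validF; comp_tac. Qed.
Lemma comp_forallF : computable forallF.
Proof. unfold forallF; comp_tac. Qed.
#[global] Hint Resolve comp_preF comp_validF comp_forallF : comp.
Lemma comp_goodF : computable goodF.
Proof. unfold goodF; comp_tac. Qed.
#[global] Hint Resolve comp_goodF : comp.
Lemma comp_winF : computable winF.
Proof. unfold winF; comp_tac. Qed.
Lemma comp_den_sum : computable den_sum.
Proof. unfold den_sum; comp_tac. Qed.
Lemma comp_qabs : computable qabs.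
Proof. unfold qabs; comp_tac. Qed.
#[global] Hint Resolve comp_winF comp_den_sum comp_qabs : comp.
Lemma comp_itv_count : computable itv_count.
Proof. unfold itv_count; comp_tac. Qed.
#[global] Hint Resolve comp_itv_count : comp.
Lemma comp_decide : computable decide.
Proof. unfold decide; comp_tac. Qed.

(** * Meaning of the winning sentence *)

Lemma holds_mem e v q : holds e (memF v q) <-> itv e v (evq e q).
Proof.
  unfold memF, itv, in_itv; rewrite !holds_and, !holds_or, !holds_and, !holds_cmp.
  rewrite !evq_var, evq_zero; unfold gt0.
  assert (H : forall a b, 0 < b - a <-> a < b) by (intros; lra).
  assert (H' : forall a b, 0 <= b - a <-> a <= b) by (intros; lra).
  rewrite !H, !H'; reflexivity.
Qed.

Definition within (lo hi : Q) (a b : R) : Prop := Q2R lo <= a /\ b <= Q2R hi.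

Lemma expresses_within e j lo hi : (1 <= j)%nat -> e O = 1 ->
  expresses e j (inEF (encQ lo) (encQ hi)) (within lo hi).
Proof.
  intros Hj He e' a b Ha; unfold inEF, within; rewrite holds_and, !holds_cmp, !evq_mul.
  rewrite <- (Ha O), He by lia; unfold gt0; lra.
Qed.

(** Both ends must lie in the same interval: by convexity everything between them then does too. *)
Definition target (N : nat) (e : env) (s : nat) (a b : R) : Prop :=
  exists k, (k < N)%nat /\ itv e (base N s k) a /\ itv e (base N s k) b.

Lemma expresses_target e j N s : (base N (S s) O <= j)%nat ->
  expresses e j (targetF N s) (target N e s).
Proof.
  intros Hj e' a b Ha; unfold targetF, target; rewrite holds_big_or.
  assert (Hk : forall k, (k < N)%nat -> itv e (base N s k) = itv e' (base N s k)).
  { intros k Hk; unfold itv, base in *; rewrite !Ha by nia; reflexivity. }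
  split; intros [k [H1 H2]]; exists k.
  - apply in_seq in H1; rewrite holds_and, !holds_mem in H2.
    rewrite (Hk k) by lia; split; [lia | assumption].
  - rewrite in_seq, holds_and, !holds_mem, <- (Hk k) by lia; split; [lia | assumption].
Qed.

Definition enc_edge (e : nat * nat * etpu) : tree :=
  Node (Node (encN (fst (fst e))) (encN (snd (fst e)))) (encETPu (snd e)).

Lemma holds_edges e f ed s :
  holds e (edgesF f (encL enc_edge ed) s) <->
  exists s' p, In (s, s', p) ed /\ holds e (f (encN s') (encETPu p)).
Proof.
  unfold edgesF; rewrite tfold_encL, holds_big_or; unfold ite; split.
  - intros [[[s1 s'] p] [Hin H]]; cbn [enc_edge tfst tsnd trec fst snd] in H.
    rewrite tnat_encN in H; destruct (Nat.eqb_spec s1 s) as [-> |].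
    + eauto.
    + destruct (holds_false _ H).
  - intros [s' [p [Hin H]]]; exists (s, s', p); split; [assumption |].
    cbn [enc_edge tfst tsnd trec fst snd]; rewrite tnat_encN, Nat.eqb_refl; assumption.
Qed.

Definition can_step (A : setau) (lo hi : Q) (X : nat -> R -> R -> Prop) (s : nat) (w : R) :
    Prop :=
  exists s' p ds, In (s, s', p) (edges A) /\ delay_seq p ds /\
    energies (within lo hi) (X s') (p_steps p) ds w w.

Lemma holds_pre A lo hi N e j w s : wf_setau A -> e O = 1 -> (base N (nS A) O <= j)%nat ->
  below j w ->
  (holds e (preF (encL enc_edge (edges A)) N (encQ lo) (encQ hi) j w s) <->
   can_step A lo hi (target N e) s (evq e w)).
Proof.
  intros [HA _] He Hj Hw; unfold preF, can_step; rewrite holds_edges.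
  assert (Hj1 : (1 <= j)%nat) by (unfold base in Hj; lia).
  assert (Hp : forall s' p, In (s, s', p) (edges A) ->
    holds e (pathF (tnat (tfst (encETPu p))) (inEF (encQ lo) (encQ hi))
      (targetF N (tnat (encN s'))) (tfst (tsnd (encETPu p))) (fun _ => qzero) j w w) <->
    exists ds, delay_seq p ds /\
      energies (within lo hi) (target N e s') (p_steps p) ds (evq e w) (evq e w)).
  { intros s' p Hin; cbn [encETPu tfst tsnd trec]; rewrite !tnat_encN.
    destruct (HA _ _ _ Hin) as [_ [Hs' _]].
    change (encL _ (p_steps p)) with (encL enc_step (p_steps p)).
    rewrite (holds_path _ _ _ (within lo hi) (target N e s')); try assumption.
    - unfold delay_seq; replace (val e (fun _ => qzero)) with (fun _ : nat => 0);
        [reflexivity |].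
      apply functional_extensionality; intros x; symmetry; apply evq_zero.
    - intros x; apply below_zero.
    - apply expresses_within; assumption.
    - apply expresses_target; unfold base in *; nia. }
  split.
  - intros [s' [p [Hin H]]]; apply (Hp s' p Hin) in H as [ds H]; eauto 6.
  - intros [s' [p [ds [Hin H]]]]; exists s', p; split; [assumption |].
    apply (Hp s' p Hin); eauto.
Qed.

Lemma energies_top st : forall n v ds a b, clock_ok n v st ds ->
  energies (fun _ _ => True) (fun _ _ => True) st ds a b.
Proof.
  induction st as [|[l t] st IH]; intros n v [|d ds] a b H; simpl in *; try tauto.
  split; [exact I |]; split; [exact I |]; eapply IH; apply H.
Qed.

Lemma holds_valid A e s : e O = 1 ->
  (holds e (validF (encL enc_edge (edges A)) s) <->
   exists s' p ds, In (s, s', p) (edges A) /\ delay_seq p ds).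
Proof.
  intros He; unfold validF; rewrite holds_edges.
  assert (Ht : expresses e 1 (fun _ _ => dtrue) (fun _ _ => True)).
  { intros e' a b _; split; [trivial | intros _; apply holds_true]. }
  assert (Hp : forall p,
    holds e (pathF (tnat (tfst (encETPu p))) (fun _ _ => dtrue)
      (fun _ _ => dtrue) (tfst (tsnd (encETPu p))) (fun _ => qzero) 1 qzero qzero) <->
    exists ds, delay_seq p ds).
  { intros p; cbn [encETPu tfst tsnd trec]; rewrite tnat_encN.
    change (encL _ (p_steps p)) with (encL enc_step (p_steps p)).
    rewrite (holds_path _ _ _ (fun _ _ => True) (fun _ _ => True));
      try assumption; try apply below_zero; try lia; [| intros x; apply below_zero].
    unfold delay_seq; replace (val e (fun _ => qzero)) with (fun _ : nat => 0).
    - split; intros [ds H]; exists ds; [tauto |].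
      split; [assumption | eapply energies_top; eassumption].
    - apply functional_extensionality; intros x; symmetry; apply evq_zero. }
  split.
  - intros [s' [p [Hin H]]]; apply Hp in H as [ds H]; eauto.
  - intros [s' [p [ds [Hin H]]]]; exists s', p; split; [assumption |]; apply Hp; eauto.
Qed.

Lemma holds_forall e f n : holds e (forallF f n) <-> forall x, (x < n)%nat -> holds e (f x).
Proof.
  unfold forallF; rewrite holds_big_and; split; intros H x Hx; apply H.
  - apply in_seq; lia.
  - apply in_seq in Hx; lia.
Qed.

Definition all_valid (A : setau) : Prop :=
  forall s, (s < nS A)%nat -> exists s' p ds, In (s, s', p) (edges A) /\ delay_seq p ds.

(** The union of the intervals is a post-fixed point of the one-traversal operator, so a condition
    on single traversals replaces the infinite horizon. *)
Definition winning_itvs (A : setau) (lo hi : Q) (s0 : nat) (w0 : Q) (N : nat) (e : env) : Prop :=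
  inE lo hi (Q2R w0) /\ can_step A lo hi (target N e) s0 (Q2R w0) /\
  forall s k w, (s < nS A)%nat -> (k < N)%nat -> itv e (base N s k) w ->
    can_step A lo hi (target N e) s w.

Lemma target_agree A N j e e' s : (base N (nS A) O <= j)%nat -> agree j e e' -> (s < nS A)%nat ->
  target N e s = target N e' s.
Proof.
  intros Hj Ha Hs; apply functional_extensionality; intros a.
  apply functional_extensionality; intros b; unfold target.
  assert (Hk : forall k, (k < N)%nat -> itv e (base N s k) = itv e' (base N s k)).
  { intros k Hk; unfold itv, base in *; rewrite !Ha by nia; reflexivity. }
  apply propositional_extensionality.
  split; intros [k [H1 H2]]; exists k; (split; [assumption |]);
    [rewrite <- Hk | rewrite Hk]; assumption.
Qed.

Lemma can_step_agree A lo hi N j e e' s w : wf_setau A -> (base N (nS A) O <= j)%nat ->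
  agree j e e' -> can_step A lo hi (target N e) s w -> can_step A lo hi (target N e') s w.
Proof.
  intros [HA _] Hj Ha [s' [p [ds [Hin H]]]]; exists s', p, ds; split; [assumption |].
  rewrite <- (target_agree A N j e e') by (try assumption; apply (HA _ _ _ Hin)); assumption.
Qed.

Lemma holds_good A lo hi s0 w0 N e : wf_setau A -> (s0 < nS A)%nat -> e O = 1 ->
  holds e (goodF (encL enc_edge (edges A)) (nS A) N (encQ lo) (encQ hi) s0 (encQ w0)
             (base N (nS A) O)) <->
  winning_itvs A lo hi s0 w0 N e.
Proof.
  intros HA Hs0 He; unfold goodF, winning_itvs; set (j := base N (nS A) O).
  rewrite !holds_and, holds_forall, holds_pre; try assumption; [| reflexivity |].
  2: { apply below_mul; unfold j, base; lia. }
  assert (Hin : forall a b, holds e (inEF (encQ lo) (encQ hi) a b) <->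
                            within lo hi (evq e a) (evq e b)).
  { intros a b; apply (expresses_within e 1); [lia | assumption | intros i _; reflexivity]. }
  rewrite Hin, evq_mul, He, Rmult_1_r.
  assert (Hx : (forall x, (x < nS A)%nat -> holds e (forallF (fun k =>
      dall j (dor (dneg (memF (base N x k) (qvar j)))
        (preF (encL enc_edge (edges A)) N (encQ lo) (encQ hi) (S j) (qvar j) x))) N)) <->
    forall s k w, (s < nS A)%nat -> (k < N)%nat -> itv e (base N s k) w ->
      can_step A lo hi (target N e) s w).
  { assert (Hall : forall s k w, (s < nS A)%nat -> (k < N)%nat ->
      holds (upd e j w) (dor (dneg (memF (base N s k) (qvar j)))
        (preF (encL enc_edge (edges A)) N (encQ lo) (encQ hi) (S j) (qvar j) s)) <->
      (itv e (base N s k) w -> can_step A lo hi (target N e) s w)).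
    { intros s k w Hs Hk.
      assert (Hag : agree j e (upd e j w)) by apply agree_upd.
      assert (Hag' : agree j (upd e j w) e) by (intros i Hi; symmetry; apply Hag, Hi).
      rewrite holds_or, holds_neg, holds_mem, holds_pre; try assumption.
      - rewrite evq_var, upd_same.
        replace (itv (upd e j w) (base N s k)) with (itv e (base N s k)).
        2: { unfold itv; rewrite !Hag by (unfold j, base; nia); reflexivity. }
        split.
        + intros [Hn | Hc] Hi; [contradiction |].
          apply (can_step_agree A lo hi N j (upd e j w) e); auto.
        + intros H; destruct (classic (itv e (base N s k) w)) as [Hi | Hn];
            [right | left; assumption].
          apply (can_step_agree A lo hi N j e (upd e j w)); auto.
      - fold j; lia.
      - apply below_var; lia. }
    split.
    - intros H s k w Hs Hk; apply Hall; try assumption.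
      specialize (H s Hs); rewrite holds_forall in H; specialize (H k Hk).
      rewrite holds_all in H; apply H.
    - intros H s Hs; apply holds_forall; intros k Hk; apply holds_all; intros w.
      apply Hall; try assumption; apply H; assumption. }
  rewrite Hx; unfold within, inE; tauto.
Qed.

Lemma holds_win A lo hi s0 w0 N : wf_setau A -> (s0 < nS A)%nat ->
  holds env0 (winF (encL enc_edge (edges A)) (nS A) N (encQ lo) (encQ hi) s0 (encQ w0)) <->
  all_valid A /\ exists e, winning_itvs A lo hi s0 w0 N e.
Proof.
  intros HA Hs0; unfold winF; rewrite holds_and, holds_forall, holds_exs.
  assert (H1 : (forall x, (x < nS A)%nat ->
      holds env0 (validF (encL enc_edge (edges A)) x)) <-> all_valid A).
  { unfold all_valid; split; intros H s Hs; specialize (H s Hs);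
      apply (holds_valid A env0 s eq_refl); assumption. }
  rewrite H1; clear H1.
  split; (intros [Hv [e He]]; split; [assumption |]).
  - destruct He as [Ha He]; exists e; apply holds_good in He; try assumption.
    rewrite Ha; [reflexivity |]; rewrite in_seq; lia.
  - set (j := base N (nS A) O).
    (* The existential block may only change the variables [1, ..., j - 1], so [e] is cut down to
       them and made equal to [env0] elsewhere. *)
    set (e' := fun y => if Nat.eqb y 0 then 1 else if Nat.ltb y j then e y else 0).
    assert (Hi : forall s k, (s < nS A)%nat -> (k < N)%nat ->
      itv e (base N s k) = itv e' (base N s k)).
    { intros s k Hs Hk.
      assert (Hy : forall y, (1 <= y < j)%nat -> e' y = e y).
      { intros y Hy; unfold e'; destruct (Nat.eqb_spec y 0); [lia |].
        destruct (Nat.ltb_spec y j); [reflexivity | lia]. }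
      unfold itv; rewrite !Hy by (unfold j, base; nia); reflexivity. }
    assert (Ht : forall s, (s < nS A)%nat -> target N e s = target N e' s).
    { intros s Hs; apply functional_extensionality; intros a.
      apply functional_extensionality; intros b; unfold target.
      apply propositional_extensionality.
      split; intros [k [Hk H]]; exists k; (split; [assumption |]);
        [rewrite <- Hi | rewrite Hi]; assumption. }
    assert (Hc : forall s w, can_step A lo hi (target N e) s w ->
                             can_step A lo hi (target N e') s w).
    { intros s w [s' [p [ds [Hin H]]]]; exists s', p, ds; split; [assumption |].
      rewrite <- Ht; [assumption |]; apply HA in Hin; apply Hin. }
    exists e'; split.
    + intros y Hy; rewrite in_seq in Hy; unfold e', env0.
      destruct (Nat.eqb_spec y 0); [reflexivity |].
      destruct (Nat.ltb_spec y j); [unfold j, base in *; lia | reflexivity].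
    + apply holds_good; try assumption; [reflexivity |].
      destruct He as [H1 [H2 H3]]; split; [assumption |]; split; [auto |].
      intros s k w Hs Hk Hw; apply Hc, (H3 s k); try assumption.
      rewrite Hi; assumption.
Qed.

Definition enough_itvs (A : setau) (lo hi : Q) : nat :=
  itv_count (encL enc_edge (edges A)) (encQ lo) (encQ hi).

Lemma decide_spec A lo hi s0 w0 : wf_setau A -> (s0 < nS A)%nat ->
  decide (enc_inst A lo hi s0 w0) = true <->
  all_valid A /\ exists e, winning_itvs A lo hi s0 w0 (enough_itvs A lo hi) e.
Proof.
  intros HA Hs0; unfold decide; rewrite dnf_true_spec.
  cbn [enc_inst encSETAu tfst tsnd trec]; rewrite !tnat_encN.
  apply holds_win; assumption.
Qed.

(** * Strategies and families of intervals *)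

Lemma energies_mono EP (KP KP' : R -> R -> Prop) st : (forall a b, KP a b -> KP' a b) ->
  forall ds a b, energies EP KP st ds a b -> energies EP KP' st ds a b.
Proof.
  intros HK; induction st as [|[l t] st IH]; intros [|d ds] a b H; simpl in *; auto; try tauto.
  destruct H as [H1 [H2 H3]]; auto.
Qed.

Lemma last_cons {A} (l : list A) : forall x d, last (x :: l) d = last l x.
Proof.
  induction l as [|y l IH]; intros x d; [reflexivity |].
  change (last (y :: l) d = last (y :: l) x); rewrite !IH; reflexivity.
Qed.

Lemma last_Forall {A} (P : A -> Prop) l : forall d, P d -> Forall P l -> P (last l d).
Proof.
  induction l as [|x l IH]; intros d Hd H; [assumption |].
  inversion_clear H; rewrite last_cons; auto.
Qed.

(** The ends move with the extreme rates and updates; as delays are nonnegative, the actual energy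
    stays between them, and [E] is convex. *)
Lemma energies_sound lo hi KP st : forall n v ds w a b ws, clock_ok n v st ds -> a <= w <= b ->
  energies (within lo hi) KP st ds a b -> energy_ok w st ds ws ->
  Forall (inE lo hi) ws /\ exists a' b', KP a' b' /\ a' <= last ws w <= b'.
Proof.
  induction st as [|[l t] st IH]; intros n v [|d ds] w a b ws Hc Hw He Ho;
    cbn [clock_ok energies energy_ok] in Hc, He, Ho; try tauto.
  - destruct ws; [| tauto]; split; [constructor |]; exists a, b; auto.
  - destruct ws as [|w1 [|w2 ws]]; try tauto.
    destruct Hc as (Hd & _ & _ & _ & Hc).
    destruct He as ((E1 & E2) & (E3 & E4) & He).
    destruct Ho as ((al & Hal & ->) & (be & Hbe & ->) & Ho).
    assert (B1 : a + d * (Q2R (l_rate l) - Q2R (l_eps l)) <= w + d * al) by nra.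
    assert (B2 : w + d * al <= b + d * (Q2R (l_rate l) + Q2R (l_eps l))) by nra.
    edestruct IH as [HF HL]; [exact Hc | | exact He | exact Ho |]; [lra |].
    split; [| rewrite !last_cons; exact HL].
    constructor; [unfold inE; lra |]; constructor; [unfold inE; lra | exact HF].
Qed.

Lemma split_sum p p' q q' y : p <= p' -> q <= q' -> p + q <= y <= p' + q' ->
  exists x z, p <= x <= p' /\ q <= z <= q' /\ y = x + z.
Proof.
  intros Hp Hq Hy; destruct (Rle_dec (y - q) p').
  - exists (y - q), q; lra.
  - exists p', (y - p'); lra.
Qed.

Lemma split_scale d p q z : 0 <= d -> p <= q -> d * p <= z <= d * q ->
  exists al, p <= al <= q /\ z = d * al.
Proof.
  intros Hd Hpq Hz; destruct (Req_dec d 0) as [-> | Hn].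
  - exists p; lra.
  - exists (z / d); assert (z = d * (z / d)) by (field; assumption).
    split; [| assumption]; split; apply Rmult_le_reg_l with d; lra.
Qed.

Definition loc_trans_pos (lt : loc * trans) : Prop :=
  0 < Q2R (l_eps (fst lt)) /\ 0 < Q2R (t_delta (snd lt)).

Lemma energy_ok_exists st : forall n v ds w, Forall loc_trans_pos st -> clock_ok n v st ds ->
  exists ws, energy_ok w st ds ws.
Proof.
  induction st as [|[l t] st IH]; intros n v [|d ds] w Hp Hc; cbn [clock_ok] in Hc; try tauto.
  - exists []; exact I.
  - inversion_clear Hp as [| ? ? [He Hd] Hp']; cbn [fst snd] in He, Hd.
    destruct Hc as (_ & _ & _ & _ & Hc).
    destruct (IH _ _ _ (w + d * Q2R (l_rate l) + Q2R (t_upd t)) Hp' Hc) as [ws Hws].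
    exists (w + d * Q2R (l_rate l) :: w + d * Q2R (l_rate l) + Q2R (t_upd t) :: ws); simpl.
    split; [exists (Q2R (l_rate l)); split; [lra | reflexivity] |].
    split; [exists (Q2R (t_upd t)); split; [lra | reflexivity] | exact Hws].
Qed.

(** Converse of [energies_sound]: every energy of the propagated interval is produced by some choice
    of rates and updates, so safety against all of them forces the whole interval, its ends
    included, to be safe. *)
Lemma energies_complete lo hi (X : R -> Prop) st : forall n v ds a b,
  Forall loc_trans_pos st -> clock_ok n v st ds -> a <= b ->
  (forall w ws, a <= w <= b -> energy_ok w st ds ws ->
     Forall (inE lo hi) ws /\ X (last ws w)) ->
  energies (within lo hi) (fun a b => forall x, a <= x <= b -> X x) st ds a b.
Proof.
  induction st as [|[l t] st IH]; intros n v [|d ds] a b Hp Hc Hab H;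
    cbn [clock_ok energies] in *; try tauto.
  - intros x Hx; apply (H x []); [assumption | exact I].
  - inversion_clear Hp as [| ? ? [He Hd] Hp']; cbn [fst snd] in He, Hd.
    destruct Hc as (Hd0 & _ & _ & _ & Hc).
    set (r := Q2R (l_rate l)) in *; set (ep := Q2R (l_eps l)) in *.
    set (u := Q2R (t_upd t)) in *; set (de := Q2R (t_delta t)) in *.
    assert (Hde : 0 <= d * ep) by nra.
    assert (Hstep : forall w al be ws, a <= w <= b -> r - ep <= al <= r + ep ->
      u - de <= be <= u + de -> energy_ok (w + d * al + be) st ds ws ->
      inE lo hi (w + d * al) /\ inE lo hi (w + d * al + be) /\ Forall (inE lo hi) ws /\
      X (last ws (w + d * al + be))).
    { intros w al be ws Hw Hal Hbe Ho.
      destruct (H w (w + d * al :: w + d * al + be :: ws)) as [HF HX]; [assumption | |].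
      - simpl; split; [exists al; split; [exact Hal | reflexivity] |].
        split; [exists be; split; [exact Hbe | reflexivity] | exact Ho].
      - rewrite !last_cons in HX; inversion_clear HF as [| ? ? F1 F2].
        inversion_clear F2; auto. }
    (* The hypothesis speaks of energies along the entire remaining path, so the two extreme first
       steps are completed by arbitrary continuations before it applies. *)
    destruct (energy_ok_exists st _ _ _ (a + d * (r - ep) + (u - de)) Hp' Hc) as [ws1 Hw1].
    destruct (energy_ok_exists st _ _ _ (b + d * (r + ep) + (u + de)) Hp' Hc) as [ws2 Hw2].
    apply Hstep in Hw1; try lra; apply Hstep in Hw2; try lra.
    destruct Hw1 as ([L1 _] & [L2 _] & _), Hw2 as ([_ U1] & [_ U2] & _).
    split; [split; assumption |]; split; [split; assumption |].
    eapply IH; [exact Hp' | exact Hc | lra |].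
    intros w ws Hw Ho.
    (* The interval after a step is the Minkowski sum of the old interval, the possible slopes times
       [d], and the possible updates; [w] is decomposed accordingly. *)
    destruct (split_sum (a + d * (r - ep)) (b + d * (r + ep)) (u - de) (u + de) w)
      as (w1 & be & Hw1 & Hbe & ->); [lra | lra | lra |].
    destruct (split_sum a b (d * (r - ep)) (d * (r + ep)) w1)
      as (w0 & z & Hw0 & Hz & ->); [lra | lra | lra |].
    destruct (split_scale d (r - ep) (r + ep) z) as (al & Hal & ->); [lra | lra | lra |].
    destruct (Hstep w0 al be ws) as (_ & _ & HF & HX); auto.
Qed.

(** A step adds [2 * d * eps + 2 * delta] to the length, and lengths never decrease. The final
    disjunction is the induction invariant: either a step is still to come, or the incoming interval
    is already long and checked by [EP]. *)
Lemma energies_wide EP KP eta st : forall n v ds a b,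
  Forall loc_trans_pos st -> Forall (fun lt => eta <= Q2R (t_delta (snd lt))) st ->
  clock_ok n v st ds -> a <= b -> energies EP KP st ds a b ->
  st <> [] \/ (EP a b /\ eta <= b - a) ->
  energies EP (fun a b => EP a b /\ eta <= b - a /\ KP a b) st ds a b.
Proof.
  induction st as [|[l t] st IH]; intros n v [|d ds] a b Hp Hw Hc Hab H Hs;
    cbn [clock_ok energies] in *; try tauto.
  inversion_clear Hp as [| ? ? [He Hd] Hp']; cbn [fst snd] in He, Hd.
  inversion_clear Hw as [| ? ? Hw1 Hw']; cbn [snd] in Hw1.
  destruct Hc as (Hd0 & _ & _ & _ & Hc); destruct H as (H1 & H2 & H3).
  assert (Hde : 0 <= d * Q2R (l_eps l)) by nra.
  split; [exact H1 |]; split; [exact H2 |].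
  eapply IH; [exact Hp' | exact Hw' | exact Hc | lra | exact H3 |].
  right; split; [exact H2 | lra].
Qed.

(** A bounded convex set is determined by its infimum, its supremum and whether it contains them;
    the last two facts are chosen classically and stored as the flags 0 or 1. *)
Lemma convex_in_itv (P : R -> Prop) lo hi :
  (forall x, P x -> lo <= x <= hi) ->
  (forall x y z, P x -> P z -> x <= y <= z -> P y) ->
  exists l u fl fu, forall x, P x <-> in_itv l u fl fu x.
Proof.
  intros Hb Hc; destruct (classic (exists x, P x)) as [[x0 H0] | Hno].
  - destruct (completeness P) as [u [Hu1 Hu2]].
    { exists hi; intros x Hx; apply Hb, Hx. }
    { exists x0; exact H0. }
    (* The infimum is minus the supremum of the reflected set. *)
    destruct (completeness (fun x => P (- x))) as [l [Hl1 Hl2]].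
    { exists (- lo); intros x Hx; apply Hb in Hx; lra. }
    { exists (- x0); rewrite Ropp_involutive; exact H0. }
    exists (- l), u, (if excluded_middle_informative (P (- l)) then 1 else 0),
      (if excluded_middle_informative (P u) then 1 else 0).
    assert (Hup : forall x, x < u -> exists y, P y /\ x < y).
    { intros x Hx; apply NNPP; intros Hn.
      assert (u <= x); [| lra].
      apply Hu2; intros y Hy; destruct (Rle_dec y x); [assumption |].
      exfalso; apply Hn; exists y; split; [assumption | lra]. }
    assert (Hlow : forall x, - l < x -> exists y, P y /\ y < x).
    { intros x Hx; apply NNPP; intros Hn.
      assert (l <= - x); [| lra].
      apply Hl2; intros y Hy; destruct (Rle_dec y (- x)); [assumption |].
      exfalso; apply Hn; exists (- y); split; [assumption | lra]. }
    intros x; unfold in_itv; split.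
    + intros Hx.
      assert (H1 : x <= u) by (apply Hu1; exact Hx).
      assert (H2 : - x <= l) by (apply Hl1; rewrite Ropp_involutive; exact Hx).
      split.
      * destruct (Rle_lt_or_eq_dec (- l) x) as [Hlt | Heq]; [lra | left; assumption |].
        right; split; [lra |]; subst x.
        destruct (excluded_middle_informative (P (- l))); [lra | contradiction].
      * destruct (Rle_lt_or_eq_dec x u) as [Hlt | Heq]; [lra | left; assumption |].
        right; split; [lra |]; subst x.
        destruct (excluded_middle_informative (P u)); [lra | contradiction].
    + intros [HL HU].
      assert (Hlo : exists y, P y /\ y <= x).
      { destruct HL as [HL | [HL HF]].
        - destruct (Hlow x HL) as [y [Hy Hyx]]; exists y; split; [assumption | lra].
        - destruct (excluded_middle_informative (P (- l))); [| lra]; eauto. }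
      assert (Hhi : exists y, P y /\ x <= y).
      { destruct HU as [HU | [HU HF]].
        - destruct (Hup x HU) as [y [Hy Hyx]]; exists y; split; [assumption | lra].
        - destruct (excluded_middle_informative (P u)); [| lra]; eauto. }
      destruct Hlo as [y [Hy Hyx]], Hhi as [z [Hz Hxz]]; apply (Hc y x z); auto.
  (* The empty set is coded by ends in the wrong order. *)
  - exists 1, 0, 0, 0; intros x; unfold in_itv; split; [intros Hx; exfalso; eauto | lra].
Qed.

Lemma in_itv_convex l u fl fu x y z :
  in_itv l u fl fu x -> in_itv l u fl fu z -> x <= y <= z -> in_itv l u fl fu y.
Proof. unfold in_itv; lra. Qed.

(** The variable numbering is injective: [y - 1 = c + 4 * (k + N * s)] with [c < 4] and [k < N], so
    two divisions with remainder recover [s], [k] and [c]. *)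
Lemma itv_env (N : nat) (I : nat -> nat -> R -> Prop) : (0 < N)%nat ->
  (forall s k, exists l u fl fu, forall x, I s k x <-> in_itv l u fl fu x) ->
  exists e, forall s k x, (k < N)%nat -> itv e (base N s k) x <-> I s k x.
Proof.
  intros HN H.
  assert (H' : forall s k, exists f : nat -> R,
    forall x, in_itv (f 0%nat) (f 1%nat) (f 2%nat) (f 3%nat) x <-> I s k x).
  { intros s k; destruct (H s k) as (l & u & fl & fu & Hx).
    exists (fun c => match c with 0 => l | 1 => u | 2 => fl | _ => fu end%nat).
    intros x; rewrite Hx; reflexivity. }
  set (F := fun s k => proj1_sig (constructive_indefinite_description _ (H' s k))).
  assert (HF : forall s k x,
    in_itv (F s k 0%nat) (F s k 1%nat) (F s k 2%nat) (F s k 3%nat) x <-> I s k x).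
  { intros s k; exact (proj2_sig (constructive_indefinite_description _ (H' s k))). }
  exists (fun y => F ((y - 1) / 4 / N)%nat ((y - 1) / 4 mod N)%nat ((y - 1) mod 4)%nat).
  intros s k x Hk; rewrite <- HF; unfold itv, base.
  assert (Hd : forall c, (c < 4)%nat ->
    let m := (c + (k + N * s) * 4)%nat in
    (m / 4 / N = s /\ (m / 4) mod N = k /\ m mod 4 = c)%nat).
  { intros c Hc m; unfold m.
    rewrite Nat.div_add, Nat.Div0.mod_add, (Nat.div_small c), (Nat.mod_small c) by lia.
    rewrite Nat.add_0_l, (Nat.mul_comm N s), Nat.div_add, Nat.Div0.mod_add by lia.
    rewrite Nat.div_small, Nat.mod_small by lia; auto. }
  assert (He : forall c, (c < 4)%nat ->
    let y := (c + S (4 * (k + N * s)))%nat in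
    F ((y - 1) / 4 / N)%nat ((y - 1) / 4 mod N)%nat ((y - 1) mod 4)%nat = F s k c).
  { intros c Hc y; unfold y.
    replace (c + S (4 * (k + N * s)) - 1)%nat with (c + (k + N * s) * 4)%nat by lia.
    destruct (Hd c Hc) as [E1 [E2 E3]]; cbv zeta in E1, E2, E3.
    rewrite E1, E2, E3; reflexivity. }
  assert (Heq : forall a b c d a' b' c' d', a = a' -> b = b' -> c = c' -> d = d' ->
    in_itv a b c d x <-> in_itv a' b' c' d' x) by (intros; subst; reflexivity).
  apply Heq; [apply (He 0%nat) | apply (He 1%nat) | apply (He 2%nat) | apply (He 3%nat)]; lia.
Qed.

(** * The grid and its constants *)

Lemma nat_between x : 0 <= x -> exists n, x <= INR n <= x + 1.
Proof.
  intros Hx; destruct (archimed x) as [H1 H2].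
  assert (Hz : (0 < up x)%Z) by (apply lt_IZR; lra).
  exists (Z.to_nat (up x)); rewrite INR_IZR_INZ, Z2Nat.id by lia; lra.
Qed.

Lemma Q2R_den q : 0 < Q2R q -> / INR (Pos.to_nat (Qden q)) <= Q2R q.
Proof.
  unfold Q2R; intros H; rewrite INR_IPR; change (IPR (Qden q)) with (IZR (Z.pos (Qden q))).
  assert (Hd : 0 < IZR (Z.pos (Qden q))) by (apply IZR_lt; reflexivity).
  apply Rinv_0_lt_compat in Hd.
  assert (Hn : (0 < Qnum q)%Z) by (apply lt_IZR; nra).
  assert (1 <= IZR (Qnum q)) by (apply IZR_le; lia); nra.
Qed.

Lemma Q2R_qabs q : - INR (qabs (encQ q)) <= Q2R q <= INR (qabs (encQ q)).
Proof.
  unfold qabs; cbn [encQ tfst tsnd trec]; rewrite plus_INR.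
  assert (Hz := z_encZ (Qnum q)); revert Hz.
  set (p := zpos (encZ (Qnum q))); set (n := zneg (encZ (Qnum q))); intros Hz.
  assert (Hp := pos_INR p); assert (Hn := pos_INR n).
  unfold Q2R; rewrite <- Hz.
  assert (Hd : 1 <= IZR (Z.pos (Qden q))) by (apply IZR_le; lia).
  assert (Hi : 0 < / IZR (Z.pos (Qden q))) by (apply Rinv_0_lt_compat; lra).
  assert (Hi' : / IZR (Z.pos (Qden q)) <= 1)
    by (rewrite <- Rinv_1; apply Rinv_le_contravar; lra).
  nra.
Qed.

Lemma fold_add_ge {X} (f : X -> nat) l x : In x l ->
  (f x <= fold_right (fun y r => (f y + r)%nat) O l)%nat.
Proof. induction l as [|y l IH]; intros []; simpl; [subst; lia | specialize (IH H); lia]. Qed.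

Definition dens (A : setau) : nat := den_sum (encL enc_edge (edges A)).

Lemma den_le A s s' p lt : In (s, s', p) (edges A) -> In lt (p_steps p) ->
  (Pos.to_nat (Qden (t_delta (snd lt))) <= dens A)%nat.
Proof.
  intros He Ht; unfold dens, den_sum; rewrite tfold_encL; apply le_S.
  set (f := fun e => tfold (fun lt r => (tpos (tsnd (tfst (tsnd (tsnd (tsnd lt))))) + r)%nat) O
                       (tfst (tsnd (tsnd (enc_edge e))))).
  eapply Nat.le_trans; [| exact (fold_add_ge f _ _ He)].
  unfold f; cbn [enc_edge encETPu tfst tsnd trec fst snd]; rewrite tfold_encL.
  set (g := fun x : loc * trans =>
    tpos (tsnd (tfst (tsnd (tsnd (tsnd (Node (encLoc (fst x)) (encTrans (snd x))))))))).
  eapply Nat.le_trans; [| exact (fold_add_ge g _ _ Ht)].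
  unfold g; cbn [encTrans encQ tfst tsnd trec]; rewrite tpos_encP; lia.
Qed.

Lemma dens_pos A : 0 < INR (dens A).
Proof. unfold dens, den_sum; apply INR_S_pos. Qed.

(** An interval at least as long as the mesh contains the first grid point not below [a]. *)
Lemma grid_point A lo hi a b : within lo hi a b -> / INR (dens A) <= b - a ->
  exists k, (k < enough_itvs A lo hi)%nat /\ a <= Q2R lo + INR k * / INR (dens A) <= b.
Proof.
  intros [Ha Hb] Hw; assert (HM := dens_pos A).
  destruct (nat_between ((a - Q2R lo) * INR (dens A))) as [k Hk]; [nra |].
  assert (Hi := Rinv_0_lt_compat _ HM).
  assert (Hk' : a <= Q2R lo + INR k * / INR (dens A) <= a + / INR (dens A)).
  { set (M := INR (dens A)) in *.
    assert (E : (a - Q2R lo) * M * / M = a - Q2R lo) by (field; lra).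
    assert (E' : M * / M = 1) by (field; lra).
    split; nra. }
  exists k; split; [| lra].
  (* The grid point is at most [b <= hi], so [k] is at most [(hi - lo) * M]. *)
  unfold enough_itvs, itv_count; fold (dens A); apply le_n_S, INR_le.
  rewrite mult_INR, plus_INR.
  assert (Hlo := Q2R_qabs lo); assert (Hhi := Q2R_qabs hi).
  assert (E : INR k = INR k * / INR (dens A) * INR (dens A)) by (field; lra).
  rewrite E; nra.
Qed.

Lemma wf_steps_pos A s s' p : wf_setau A -> In (s, s', p) (edges A) ->
  Forall loc_trans_pos (p_steps p).
Proof.
  intros [HA _] Hin; destruct (HA _ _ _ Hin) as (_ & _ & Hp & _).
  eapply Forall_impl; [| exact Hp]; intros [l t] [[_ Hl] [_ [_ Ht]]]; cbn [fst snd] in *.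
  split; cbn [fst snd]; rewrite <- RMicromega.Q2R_0; apply Qlt_Rlt; assumption.
Qed.

Lemma wf_steps_delta A s s' p : wf_setau A -> In (s, s', p) (edges A) ->
  Forall (fun lt => / INR (dens A) <= Q2R (t_delta (snd lt))) (p_steps p).
Proof.
  intros HA Hin; assert (Hp := wf_steps_pos _ _ _ _ HA Hin).
  rewrite Forall_forall in Hp |- *; intros lt Hlt.
  destruct (Hp lt Hlt) as [_ Hd]; eapply Rle_trans; [| apply Q2R_den; exact Hd].
  apply Rinv_le_contravar; [apply lt_0_INR, Pos2Nat.is_pos |].
  apply le_INR; eapply den_le; eassumption.
Qed.

(** * From a strategy to intervals *)

Definition reach (A : setau) (sg : strategy) (s0 : nat) (w0 : R) (s : nat) (w : R) : Prop :=
  exists k ss ws rho, execution_prefix A sg s0 w0 k ss ws rho /\ ss k = s /\ ws k = w.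

Definition set_at {X} (f : nat -> X) (k : nat) (x : X) : nat -> X :=
  fun i => if Nat.eqb i k then x else f i.

Lemma set_at_same {X} (f : nat -> X) k x : set_at f k x k = x.
Proof. unfold set_at; rewrite Nat.eqb_refl; reflexivity. Qed.

Lemma set_at_other {X} (f : nat -> X) k x i : i <> k -> set_at f k x i = f i.
Proof. intros H; apply Nat.eqb_neq in H; unfold set_at; rewrite H; reflexivity. Qed.

Lemma prefix_extend A sg s0 w0 k ss ws rho p r :
  execution_prefix A sg s0 w0 k ss ws rho ->
  In (ss k, fst (sg (ss k) (ws k)), p) (edges A) ->
  etpu_outcome p (ws k) (snd (sg (ss k) (ws k))) r ->
  execution_prefix A sg s0 w0 (S k) (set_at ss (S k) (fst (sg (ss k) (ws k))))
    (set_at ws (S k) (last r (ws k))) (set_at rho k r).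
Proof.
  intros (H1 & H2 & H3) Hin Hr.
  split; [rewrite set_at_other by lia; exact H1 |].
  split; [rewrite set_at_other by lia; exact H2 |].
  intros i Hi; rewrite (set_at_other ss (S k) _ i), (set_at_other ws (S k) _ i) by lia.
  destruct (Nat.eq_dec i k) as [-> | Hne].
  - rewrite !set_at_same; eauto.
  - rewrite !set_at_other by lia; apply H3; lia.
Qed.

(** The invariant is the set of configurations reachable under the given strategy: finite prefixes
    extend by one traversal, so it is safe and closed under moves. Keeping only the components
    through grid points loses no interval in which a traversal can end. *)
Lemma strategy_to_itvs A lo hi s0 w0 : wf_setau A -> (s0 < nS A)%nat -> restrictionR A ->
  infinite_run_problem A lo hi s0 w0 ->
  all_valid A /\ exists e, winning_itvs A lo hi s0 w0 (enough_itvs A lo hi) e.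
Proof.
  intros HA Hs0 HR [sg [Hval Hsafe]].
  set (X := reach A sg s0 (Q2R w0)).
  assert (HX0 : X s0 (Q2R w0)).
  { exists O, (fun _ => s0), (fun _ => Q2R w0), (fun _ => []).
    split; [| auto]; split; [reflexivity |]; split; [reflexivity |].
    intros i Hi; lia. }
  assert (HXE : forall s w, X s w -> inE lo hi w).
  { intros s w (k & ss & ws & rho & Hp & _ & <-); apply (Hsafe _ _ _ _ Hp); lia. }
  assert (HXS : forall s w, X s w -> (s < nS A)%nat).
  { intros s w (k & ss & ws & rho & (E1 & _ & Hp) & <- & _).
    destruct k as [|k]; [rewrite E1; assumption |].
    destruct (Hp k) as (p & Hin & _ & -> & _); [lia |]; apply HA in Hin; apply Hin. }
  assert (HXstep : forall s w p r, X s w -> In (s, fst (sg s w), p) (edges A) ->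
    etpu_outcome p w (snd (sg s w)) r ->
    Forall (inE lo hi) r /\ X (fst (sg s w)) (last r w)).
  { intros s w p r (k & ss & ws & rho & Hp & <- & <-) Hin Hr.
    assert (Hp' := prefix_extend _ _ _ _ _ _ _ _ _ _ Hp Hin Hr); split.
    - destruct (Hsafe _ _ _ _ Hp') as [_ HF]; specialize (HF k); rewrite set_at_same in HF.
      apply HF; lia.
    - do 4 eexists; split; [exact Hp' |]; rewrite !set_at_same; auto. }
  assert (HE : inE lo hi (Q2R w0)) by (eapply HXE; exact HX0).
  split.
  { intros s Hs; destruct (Hval s (Q2R w0) Hs HE) as (p & Hin & Hd); eauto. }
  set (g := fun k => Q2R lo + INR k * / INR (dens A)).
  (* the component of [X s] containing the [k]-th grid point *)
  set (C := fun s k x => forall y, (x <= y <= g k \/ g k <= y <= x) -> X s y).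
  assert (HCX : forall s k x, C s k x -> X s x).
  { intros s k x H; apply H; destruct (Rle_dec x (g k)); lra. }
  assert (HCI : forall s k, exists l u fl fu, forall x, C s k x <-> in_itv l u fl fu x).
  { intros s k; apply (convex_in_itv _ (Q2R lo) (Q2R hi)).
    - intros x Hx; apply (HXE s), (HCX s k), Hx.
    - intros x y z Hx Hz Hy t [Ht | Ht]; [apply Hx | apply Hz]; lra. }
  destruct (itv_env (enough_itvs A lo hi) C) as [e He]; [apply Nat.lt_0_succ | exact HCI |].
  assert (Hcan : forall s w, X s w ->
    can_step A lo hi (target (enough_itvs A lo hi) e) s w).
  { intros s w Hsw; destruct (Hval s w) as (p & Hin & Hd); [eauto | eauto |].
    exists (fst (sg s w)), p, (snd (sg s w)); split; [assumption |]; split; [assumption |].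
    assert (Hpos := wf_steps_pos _ _ _ _ HA Hin).
    assert (Hdel := wf_steps_delta _ _ _ _ HA Hin).
    assert (Hen : energies (within lo hi) (fun a b => forall x, a <= x <= b -> X (fst (sg s w)) x)
                    (p_steps p) (snd (sg s w)) w w).
    { eapply energies_complete; [exact Hpos | exact Hd | apply Rle_refl |].
      intros w' r Hw' Ho; assert (w' = w) as -> by lra.
      apply (HXstep s w p); [assumption | assumption | split; assumption]. }
    (* Restriction (R) enters here: a path with a guard atom has a step, which is what makes the
       final interval long. *)
    assert (Hne : p_steps p <> []).
    { destruct (HR _ _ _ Hin) as [lt [Hlt _]]; intros E; rewrite E in Hlt; destruct Hlt. }
    apply (energies_wide _ _ _ _ _ _ _ _ _ Hpos Hdel Hd (Rle_refl w)) in Hen;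
      [| left; exact Hne].
    eapply energies_mono; [| exact Hen]; cbv beta; intros a b (Hwi & Hwide & HK).
    destruct (grid_point A lo hi a b Hwi Hwide) as [k [Hk Hg]]; fold (g k) in Hg.
    assert (0 < / INR (dens A)) by apply Rinv_0_lt_compat, dens_pos.
    exists k; split; [assumption |]; rewrite !He by assumption.
    split; intros y Hy; apply HK; lra. }
  exists e; split; [assumption |]; split; [auto |].
  intros s k w _ Hk Hw; apply Hcan, (HCX s k), He; assumption.
Qed.

Lemma edge_unique A s s' p p' : wf_setau A ->
  In (s, s', p) (edges A) -> In (s, s', p') (edges A) -> p = p'.
Proof.
  intros [_ Hnd] H H'; revert Hnd H H'; induction (edges A) as [|[q r] l IH]; [intros _ [] |].
  cbn [map fst]; intros Hnd H H'; inversion_clear Hnd as [| ? ? Hn Hnd'].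
  assert (Hno : forall r', In (q, r') l -> False).
  { intros r' Hr; apply Hn; exact (in_map fst _ _ Hr). }
  destruct H as [H | H], H' as [H' | H']; try (apply IH; assumption).
  - congruence.
  - injection H as -> ->; destruct (Hno _ H').
  - injection H' as -> ->; destruct (Hno _ H).
Qed.

Lemma prefix_restrict A sg s0 w0 k ss ws rho :
  execution_prefix A sg s0 w0 (S k) ss ws rho -> execution_prefix A sg s0 w0 k ss ws rho.
Proof. intros (H1 & H2 & H3); repeat split; try assumption; intros i Hi; apply H3; lia. Qed.

Lemma itvs_to_strategy A lo hi s0 w0 N e : wf_setau A -> (s0 < nS A)%nat ->
  all_valid A -> winning_itvs A lo hi s0 w0 N e -> infinite_run_problem A lo hi s0 w0.
Proof.
  intros HA Hs0 Hval (HE & Hc0 & Hc).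
  set (T := fun s w (m : nat * list R) => exists p,
    In (s, fst m, p) (edges A) /\ delay_seq p (snd m) /\
    energies (within lo hi) (target N e (fst m)) (p_steps p) (snd m) w w).
  set (V := fun (s : nat) (m : nat * list R) => exists p,
    In (s, fst m, p) (edges A) /\ delay_seq p (snd m)).
  assert (Hsg : forall s w, exists m, ((exists m', T s w m') -> T s w m) /\
                              ((s < nS A)%nat -> V s m)).
  { intros s w; destruct (classic (exists m', T s w m')) as [[m Hm] | Hno].
    - exists m; split; [auto |]; intros _.
      destruct Hm as (p & Hin & Hd & _); exists p; auto.
    - destruct (classic (s < nS A)%nat) as [Hs | Hs].
      + destruct (Hval s Hs) as (s' & p & ds & Hin & Hd).
        exists (s', ds); split; [contradiction |]; intros _; exists p; auto.
      + exists (O, []); split; [contradiction | contradiction]. }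
  set (sg := fun s w => proj1_sig (constructive_indefinite_description _ (Hsg s w))).
  assert (HT : forall s w, (exists m, T s w m) -> T s w (sg s w)).
  { intros s w; apply (proj2_sig (constructive_indefinite_description _ (Hsg s w))). }
  assert (HV : forall s w, (s < nS A)%nat -> V s (sg s w)).
  { intros s w; apply (proj2_sig (constructive_indefinite_description _ (Hsg s w))). }
  clearbody sg.
  exists sg; split.
  { intros s w Hs _; exact (HV s w Hs). }
  set (X := fun s w => (s < nS A)%nat /\
    ((s = s0 /\ w = Q2R w0) \/ exists k, (k < N)%nat /\ itv e (base N s k) w)).
  assert (HXc : forall s w, X s w -> exists m, T s w m).
  { intros s w [Hs Hw].
    assert (H : can_step A lo hi (target N e) s w).
    { destruct Hw as [[-> ->] | [k [Hk Hw]]]; [assumption | eapply Hc; eassumption]. }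
    destruct H as (s' & p & ds & Hin & Hd & He).
    exists (s', ds), p; auto. }
  assert (Hstep : forall s w p r, X s w -> inE lo hi w ->
    In (s, fst (sg s w), p) (edges A) -> etpu_outcome p w (snd (sg s w)) r ->
    Forall (inE lo hi) r /\ inE lo hi (last r w) /\ X (fst (sg s w)) (last r w)).
  { intros s w p r HX Hw Hin [Hd Ho].
    destruct (HT s w (HXc s w HX)) as (p' & Hin' & _ & He).
    rewrite <- (edge_unique A s (fst (sg s w)) p p') in He by assumption.
    destruct (energies_sound lo hi _ _ _ _ _ w _ _ r Hd (conj (Rle_refl w) (Rle_refl w)) He Ho)
      as [HF (a & b & (k & Hk & Ha & Hb) & Hab)].
    split; [assumption |]; split.
    - apply last_Forall; assumption.
    - split; [apply HA in Hin; apply Hin |]; right; exists k; split; [assumption |].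
      exact (in_itv_convex _ _ _ _ _ _ _ Ha Hb Hab). }
  assert (Hinv : forall k ss ws rho, execution_prefix A sg s0 (Q2R w0) k ss ws rho ->
    (forall i, (i <= k)%nat -> X (ss i) (ws i) /\ inE lo hi (ws i)) /\
    (forall i, (i < k)%nat -> Forall (inE lo hi) (rho i))).
  { induction k as [|k IH]; intros ss ws rho Hp.
    - destruct Hp as (H1 & H2 & _); split; [| intros i Hi; lia].
      intros i Hi; assert (i = O) as -> by lia; rewrite H1, H2.
      split; [split; auto | assumption].
    - destruct (IH ss ws rho (prefix_restrict _ _ _ _ _ _ _ _ Hp)) as [HX HF].
      destruct Hp as (_ & _ & H3); destruct (H3 k) as (p & Hin & Ho & Es & Ew); [lia |].
      destruct (HX k (le_n k)) as [HXk HEk].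
      destruct (Hstep _ _ _ _ HXk HEk Hin Ho) as (F1 & F2 & F3).
      rewrite <- Es, <- Ew in F3; rewrite <- Ew in F2.
      split; intros i Hi.
      + destruct (Nat.eq_dec i (S k)) as [-> | Hne]; [auto | apply HX; lia].
      + destruct (Nat.eq_dec i k) as [-> | Hne]; [auto | apply HF; lia]. }
  intros k ss ws rho Hp; destruct (Hinv k ss ws rho Hp) as [H1 H2].
  split; [intros i Hi; apply H1, Hi | exact H2].
Qed.

Theorem mainTheorem5 :
  exists prog : term,
    forall (A : setau) (lo hi : Q) (s0 : nat) (w0 : Q),
      wf_setau A -> (s0 < nS A)%nat -> restrictionR A ->
      decides_on prog (enc_inst A lo hi s0 w0)
                 (infinite_run_problem A lo hi s0 w0).
Proof.
  destruct (comp_decides decide comp_decide) as [prog Hprog].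
  exists prog; intros A lo hi s0 w0 HA Hs0 HR; apply Hprog.
  rewrite decide_spec by assumption; split.
  - intros [Hv [e He]]; eapply itvs_to_strategy; eassumption.
  - apply strategy_to_itvs; assumption.
Qed.
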